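(* Let $d\ge 1$ and $p\ge 1$ be integers. Let $\mathcal S$ and $\mathcal R$ be the sampling and reconstruction spaces in $L^2([0,1]^d)$ spanned by the $d$-dimensional Walsh functions and by the separable boundary (boundary-corrected Daubechies) wavelets of order $p$, respectively, with finite-dimensional subspaces $\mathcal S_M$ and $\mathcal R_N$ as defined in the context. For every $\theta\in(1,\infty)$ there exists a constant $S_\theta$ (not depending on $R$) such that, for all $R\in\mathbb N$ with $2^R\ge 2p-1$ and $N=2^{dR}$, and for all admissible numbers of samples $M\ge 2^{dR}S_\theta$, one has $$\mu(\mathcal R_N,\mathcal S_M)\le\theta .$$ In particular, $\Theta(N,\theta)\le S_\theta N$. Hence $\Theta(N,\theta)=\mathcal O(N)$ (for $N=2^{dR}$, $R\to\infty$) for all $\theta\in(1,\infty)$.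
   Context: Subspace angle and stable sampling rate. For closed subspaces $U,V$ of a Hilbert space, with $P_V$ the orthogonal projection onto $V$, $\mu(U,V)\in[1,\infty]$ is defined by $$\frac1{\mu(U,V)}=\inf_{u\in U,\ \|u\|=1}\|P_Vu\| .$$ The stable sampling rate is $\Theta(N,\theta)=\min\{M:\ \mu(\mathcal R_N,\mathcal S_M)\le\theta\}$, the minimum being over admissible numbers of samples $M$ (see below). Walsh functions. For an integer $s\ge0$ with binary expansion $s=\sum_{i\ge0}s_i2^i$ and $x\in[0,1)$ with dyadic expansion $x=\sum_{i\le-1}x_i2^i$ (the terminating expansion being used for dyadic rationals), set $x_0:=0$ and $$\operatorname{Wal}(s,x)=\operatorname{wal}(s;x)=(-1)^{\sum_{i\ge0}s_i(x_{-i-1}+x_{-i})}$$ (Walsh functions in Walsh–Kaczmarz, i.e. sequency, ordering). For $l=(l_1,\dots,l_d)$ with integers $l_k\ge0$ and $x\in[0,1)^d$, $\operatorname{Wal}(l,x)=\prod_{k=1}^d\operatorname{Wal}(l_k,x_k)$. Sampling space. A number of samples $M$ is admissible if $M=m^d$ for some $m\in\mathbb N$ (so every $M\in\mathbb{N}$ is admissible when $d=1$), and then $$\mathcal S_M=\operatorname{span}\{\operatorname{Wal}(l,\cdot):\ l=(l_1,\dots,l_d),\ 0\le l_k\le m-1 \text{ for } k=1,\dots,d\}\subset L^2([0,1]^d).$$ Reconstruction space. Let $\phi$ be the Daubechies scaling function of order $p$, normalized to have support $[-p+1,p]$ ($p=1$ is the Haar case $\phi=\mathbf 1_{[0,1]}$).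 For $n=0,\dots,p-1$ let $$\widetilde\phi^{\,\mathrm{left}}_n(x)=\sum_{l=0}^{2p-2}\binom ln\phi(x+l-p+1),\qquad x\in[0,\infty),$$ and let $\phi^{\mathrm{left}}_0,\dots,\phi^{\mathrm{left}}_{p-1}$ be obtained from these functions by Gram–Schmidt orthonormalization in $L^2([0,\infty))$, so that both families have the same span. The right boundary functions are the reflections $\phi^{\mathrm{right}}_n(x)=\phi^{\mathrm{left}}_n(-x)$, $x\in(-\infty,0]$, $n=0,\dots,p-1$. For $R\in\mathbb N$ with $2^R\ge2p-1$ define on $[0,1]$ $$\phi^b_{R,n}(x)=\begin{cases}2^{R/2}\phi^{\mathrm{left}}_n(2^Rx), & n=0,\dots,p-1,\\ 2^{R/2}\phi(2^Rx-n), & n=p,\dots,2^R-p-1,\\ 2^{R/2}\phi^{\mathrm{right}}_{2^R-n-1}(2^R(x-1)), & n=2^R-p,\dots,2^R-1,\end{cases}$$ and $V_R^b=\operatorname{span}\{\phi^b_{R,n}:n=0,\dots,2^R-1\}\subset L^2([0,1])$. For $N=2^{dR}$ the reconstruction space (the space of separable boundary wavelets up to scale $R$, which coincides with the scaling space at level $R$) is $$\mathcal R_N=V_R^{b,d}=V_R^b\otimes\cdots\otimes V_R^b\ (d\text{ times})\subset L^2([0,1]^d).$$ *)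

(* Defs.v *)
From HB Require Import structures.
From mathcomp Require Import all_boot all_order all_algebra.
From mathcomp Require Import all_classical all_reals all_analysis.

Set Implicit Arguments.
Unset Strict Implicit.
Unset Printing Implicit Defensive.

Import Order.TTheory GRing.Theory Num.Theory.
Import numFieldNormedType.Exports.

Local Open Scope classical_set_scope.
Local Open Scope ring_scope.

(** * Subspaces of L2 and the subspace angle

Elements of the real space L2(mu) are represented by functions.  Everything
below depends on them only up to mu-almost everywhere equality. *)

Section L2.
Context {d : measure_display} {T : measurableType d} {R : realType}.
Variable mu : {measure set T -> \bar R}.
Implicit Types (f g u v : T -> R) (U V A : set (T -> R)).

Definition dotp f g : R := \int[mu]_x (f x * g x).

Definition lspan A : set (T -> R) :=
  [set f | exists (n : nat) (c : 'I_n -> R) (g : 'I_n -> T -> R),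
     (forall i, A (g i)) /\ f = (fun x => \sum_(i < n) c i * g i x)].

(** P_V u, for V finite-dimensional (or closed): the v in V with u - v
orthogonal to V. *)
Definition orth_proj V u : T -> R :=
  xget (cst 0) [set v | V v /\
                  forall w, V w -> dotp (fun x => u x - v x) w = 0].

(** In [\bar R], the inverse of 0 is [+oo]. *)
Definition subspace_angle U V : \bar R :=
  ((ereal_inf [set 'N[mu]_2%:E[EFin \o orth_proj V u]
              | u in [set u | U u /\ 'N[mu]_2%:E[EFin \o u] = 1]])^-1)%E.

Fixpoint gram_schmidt_seq (v : nat -> T -> R) (n : nat) : seq (T -> R) :=
  if n is k.+1 then
    let s := gram_schmidt_seq v k in
    let w := fun x => v k x - \sum_(e <- s) dotp (v k) e * e x in
    rcons s (fun x => (Num.sqrt (dotp w w))^-1 * w x)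
  else [::].

Definition gram_schmidt (v : nat -> T -> R) (n : nat) : T -> R :=
  nth (cst 0) (gram_schmidt_seq v n.+1) n.

End L2.

(** * Lebesgue measure on [0, 1]^d *)

Section cube.
Context {R : realType}.

Definition leb01 : set (measurableTypeR R) -> \bar R :=
  mrestr (@lebesgue_measure R) (measurable_itv `[0, 1]).

HB.instance Definition _ := Measure.on leb01.

Lemma leb01_fin : fin_num_fun leb01.
Proof.
move=> A mA; rewrite ge0_fin_numE ?measure_ge0//.
apply: (@le_lt_trans _ _ (@lebesgue_measure R `[0, 1])).
  apply: le_measure; rewrite ?inE//; first exact: measurableI.
by rewrite lebesgue_measure_itv/= lte01 oppr0 adde0 ltry.
Qed.

HB.instance Definition _ := @Measure_isFinite.Build _ _ R leb01 leb01_fin.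

Local Notation RM := (measurableTypeR R).

Definition cons_pair (d : nat) (z : d.-tuple RM * RM) : d.+1.-tuple RM :=
  [tuple of z.2 :: z.1].

Lemma measurable_cons_pair (d : nat) :
  measurable_fun [set: d.-tuple RM * RM] (@cons_pair d).
Proof. exact: measurable_cons. Qed.

Definition cube_step (d : nat) (m : {measure set (d.-tuple RM) -> \bar R}) :
    set (d.+1.-tuple RM) -> \bar R :=
  pushforward (m \x leb01)%E (@cons_pair d).

HB.instance Definition _ (d : nat) (m : {measure set (d.-tuple RM) -> \bar R}) :=
  Measure.copy (cube_step m)
    (measure_function_pushforward__canonical__measure_function_Measure
       (m \x leb01)%E (@measurable_cons_pair d)).

Fixpoint cube_measure (d : nat) : {measure set (d.-tuple RM) -> \bar R} :=
  match d with
  | 0 => \d_([tuple] : 0.-tuple RM)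
  | k.+1 => cube_step (cube_measure k)
  end.

End cube.

(** * Walsh functions and the sampling spaces *)

Section walsh.
Context {R : realType}.

(** s_i, for s = sum_i s_i 2^i. *)
Definition bin_digit (s i : nat) : nat := odd (s %/ 2 ^ i).

(** x_{-j}, for x in [0, 1) and x_0 = 0; rounding down selects the terminating
expansion of a dyadic rational. *)
Definition dyadic_digit (x : R) (j : nat) : nat :=
  if j == 0%N then 0%N else odd (Num.truncn (2 ^+ j * x)).

(** The sum can stop at i < s because s_i = 0 for i >= s. *)
Definition wal (s : nat) (x : R) : R :=
  (-1) ^+ (\sum_(i < s)
             bin_digit s i * (dyadic_digit x i.+1 + dyadic_digit x i))%N.

Definition Wal (d : nat) (l : 'I_d -> nat) (x : d.-tuple (measurableTypeR R)) :
    R :=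
  \prod_(k < d) wal (l k) (tnth x k).

Definition admissible (d M : nat) : Prop := exists m, M = (m ^ d)%N.

(** S_M; empty if M is not admissible. *)
Definition sampling_space (d M : nat) :
    set (d.-tuple (measurableTypeR R) -> R) :=
  [set f | exists2 m, M = (m ^ d)%N &
     lspan [set g | exists2 l : 'I_d -> nat,
                      (forall k, l k < m)%N & g = Wal l] f].

End walsh.

Arguments sampling_space {R} d M _.

(** * Daubechies scaling functions and the reconstruction spaces *)

Section wavelets.
Context {R : realType}.
Local Notation RM := (measurableTypeR R).
Local Notation leb := (@lebesgue_measure R).

(** The wavelet of a scaling function phi whose filter has the 2p taps
[h 0, ..., h (2p - 1)] placed at the integers -p+1, ..., p:
psi(x) = sqrt 2 sum_k (-1)^k h_{1-k} phi(2x - k), up to sign. *)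
Definition wavelet (p : nat) (h : nat -> R) (phi : RM -> R) : RM -> R :=
  fun x => Num.sqrt 2 * \sum_(k < p.*2)
    (-1) ^+ k * h (p.*2.-1 - k)%N * phi (2 * x - (k%:R - p%:R + 1)).

(** An orthonormal scaling function with support in [-p+1, p] and 2p filter
taps (the shortest length compatible with p vanishing moments), whose wavelet
has p vanishing moments.  This leaves open the choice of the spectral factor of
the filter (extremal phase, least asymmetric, etc.), to which the boundary
construction is indifferent. *)
Record daubechies (p : nat) (phi : RM -> R) : Prop := Daubechies {
  daubechies_L2 : phi \in Lfun leb 2%:E;
  daubechies_supp :
    {ae leb, forall x, x \notin `[- p%:R + 1, p%:R] -> phi x = 0};
  daubechies_mean : \int[leb]_x phi x = 1;
  daubechies_orthonormal : forall k : int,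
    dotp leb phi (fun x => phi (x - k%:~R)) = (k == 0)%:R;
  daubechies_filter : exists h : nat -> R,
    {ae leb, forall x, phi x = Num.sqrt 2 * \sum_(k < p.*2)
                         h k * phi (2 * x - (k%:R - p%:R + 1))} /\
    (forall j, (j < p)%N -> \int[leb]_x (x ^+ j * wavelet p h phi x) = 0)
}.

Variables (p : nat) (phi : RM -> R).

Definition halfline : set RM -> \bar R :=
  mrestr leb (measurable_itv `[0, +oo[).

HB.instance Definition _ := Measure.on halfline.

(** The functions on [0, +oo[ are only evaluated there. *)
Definition phi_left_tilde (n : nat) : RM -> R := fun x =>
  \sum_(l < p.*2.-1) 'C(l, n)%:R * phi (x + l%:R - p%:R + 1).

Definition phi_left (n : nat) : RM -> R :=
  gram_schmidt halfline phi_left_tilde n.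

Definition phi_right (n : nat) : RM -> R := fun x => phi_left n (- x).

Definition phi_b (r n : nat) : RM -> R := fun x =>
  Num.sqrt (2 ^+ r) *
    (if (n < p)%N then phi_left n (2 ^+ r * x)
     else if (n < 2 ^ r - p)%N then phi (2 ^+ r * x - n%:R)
     else phi_right (2 ^ r - n - 1) (2 ^+ r * (x - 1))).

Definition V_b (r : nat) : set (RM -> R) :=
  lspan [set f | exists2 n, (n < 2 ^ r)%N & f = phi_b r n].

(** The d-fold tensor power of a finite-dimensional V. *)
Definition tensor_power (d : nat) (V : set (RM -> R)) : set (d.-tuple RM -> R) :=
  lspan [set f | exists2 g : 'I_d -> RM -> R, (forall k, V (g k)) &
                   f = fun x => \prod_(k < d) g k (tnth x k)].

(** R_N; empty if N is not of the form 2^(d R). *)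
Definition reconstruction_space (d N : nat) : set (d.-tuple RM -> R) :=
  [set f | exists2 r, N = (2 ^ (d * r))%N & tensor_power (V_b r) f].

Arguments reconstruction_space : clear implicits.

(** Theta(N, theta), as an extended real: [+oo] if no M qualifies, the minimum
otherwise. *)
Definition stable_sampling_rate (d N : nat) (theta : R) : \bar R :=
  ereal_inf [set M%:R%:E | M in
    [set M | admissible d M /\
       (subspace_angle (cube_measure d) (reconstruction_space d N)
          (sampling_space d M) <= theta%:E)%E]].

End wavelets.

Arguments reconstruction_space {R} p phi d N _.

(* Main.v *)
From HB Require Import structures.
Require Import Defs.
From mathcomp Require Import all_boot all_order all_algebra.
From mathcomp Require Import all_classical all_reals all_analysis.
From mathcomp Require Import measurable_realfun.
From mathcomp Require Import ring lra.

Set Implicit Arguments.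
Unset Strict Implicit.
Unset Printing Implicit Defensive.

Import Order.TTheory GRing.Theory Num.Theory.
Import numFieldNormedType.Exports.

Local Open Scope classical_set_scope.
Local Open Scope ring_scope.

(** The scaling function enters only through its square integrability and its
compact support.

Rescale by 2^r and cut [0, 2^r] into unit cells.  On one cell every element of
V_r^b - a combination of integer translates of phi, or, near the right end, of
reflected translates - is a combination of the finitely many functions
t |-> phi(t + q) and t |-> phi(-t + q), 0 <= t < 1, whose support meets the
cell.  These span a finite-dimensional space that depends neither on the cell
nor on r; let e_0, ..., e_{D-1} be an orthonormal basis of it ([local_basis]).
Hence V_r^b lies in the span of the orthonormal functions
E_{i,b}(x) = 2^{r/2} e_b(2^r x - i), i < 2^r, b < D ([V_b_dilates]), and its
d-fold tensor power in the span of their orthonormal tensor products.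

Dyadic step functions are dense in L2([0, 1]) ([dyadic_step_dense]), so for some
j all the e_b are within eta of step functions of level j.  Dilating these gives
step functions G_{i,b} of level r + j, still within eta of E_{i,b} and supported
in the same cell, and step functions of level r + j are combinations of the
first 2^{r+j} Walsh functions ([dyadic_step_walsh]).  Replacing each E by the
corresponding G in the expansion of u in the tensor products of the E_{i,b}
gives w in S_M as soon as M >= 2^{d(r+j)}.  The errors made on different cubes
are orthogonal and each cube carries D^d basis functions, so |u - w|^2 is at
most D^d times a quantity that tends to 0 with eta, times |u|^2, uniformly in r
([tensor_approx]).  Since |P u|^2 >= |u|^2 - |u - w|^2, choosing eta small for
the given theta bounds the subspace angle, with the constant 2^{dj}. *)

(** * Semi-inner products *)

Section SemiInnerProduct.
Variables (R : realType) (V : lmodType R) (S : V -> Prop) (B : V -> V -> R).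
Implicit Types (u v w : V).

Record semi_inner_product : Prop := SemiInnerProduct {
  sip0 : S 0;
  sipD : forall u v, S u -> S v -> S (u + v);
  sipZ : forall a u, S u -> S (a *: u);
  sipC : forall u v, S u -> S v -> B u v = B v u;
  sipDl : forall u v w, S u -> S v -> S w -> B (u + v) w = B u w + B v w;
  sipZl : forall a u v, S u -> S v -> B (a *: u) v = a * B u v;
  sip_ge0 : forall u, S u -> 0 <= B u u
}.

Hypothesis HB : semi_inner_product.

Lemma sip_sum I (r : seq I) (P : pred I) (f : I -> V) :
  (forall i, P i -> S (f i)) -> S (\sum_(i <- r | P i) f i).
Proof. by move=> Sf; apply: (big_ind S (sip0 HB) (sipD HB)). Qed.

Lemma sip_lincomb I (r : seq I) (P : pred I) (c : I -> R) (f : I -> V) :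
  (forall i, P i -> S (f i)) -> S (\sum_(i <- r | P i) c i *: f i).
Proof. by move=> Sf; apply: sip_sum => i Pi; apply: (sipZ HB); exact: Sf. Qed.

Lemma sipN u : S u -> S (- u).
Proof. by move=> Su; rewrite -scaleN1r; exact: (sipZ HB). Qed.

Lemma sipB u v : S u -> S v -> S (u - v).
Proof. by move=> Su Sv; apply: (sipD HB) => //; exact: sipN. Qed.

Lemma sip0l w : S w -> B 0 w = 0.
Proof. by move=> Sw; rewrite -(scale0r 0) (sipZl HB) ?mul0r//; exact: (sip0 HB). Qed.

Lemma sipNl u w : S u -> S w -> B (- u) w = - B u w.
Proof. by move=> Su Sw; rewrite -scaleN1r (sipZl HB)// mulN1r. Qed.

Lemma sipBl u v w : S u -> S v -> S w -> B (u - v) w = B u w - B v w.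
Proof. by move=> Su Sv Sw; rewrite (sipDl HB)// ?sipNl//; exact: sipN. Qed.

Lemma sip_lincombl I (r : seq I) (P : pred I) (c : I -> R) (f : I -> V) w :
  S w -> (forall i, P i -> S (f i)) ->
  B (\sum_(i <- r | P i) c i *: f i) w = \sum_(i <- r | P i) c i * B (f i) w.
Proof.
move=> Sw Sf; elim: r => [|i r IH]; first by rewrite !big_nil sip0l.
rewrite !big_cons; case: ifPn => // Pi.
have Si := Sf _ Pi.
rewrite (sipDl HB)//; [|exact: (sipZ HB)|exact: sip_lincomb].
by rewrite (sipZl HB)// IH.
Qed.

Lemma sipDr u v w : S u -> S v -> S w -> B w (u + v) = B w u + B w v.
Proof.
by move=> *; rewrite !(@sipC HB w)// ?(sipDl HB)//; exact: (sipD HB).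
Qed.

Lemma sipBr u v w : S u -> S v -> S w -> B w (u - v) = B w u - B w v.
Proof. by move=> *; rewrite !(@sipC HB w)// ?sipBl//; exact: sipB. Qed.

Lemma sipZr a u w : S u -> S w -> B w (a *: u) = a * B w u.
Proof. by move=> *; rewrite !(@sipC HB w)// ?(sipZl HB)//; exact: (sipZ HB). Qed.

Lemma sip_lincombr I (r : seq I) (P : pred I) (c : I -> R) (f : I -> V) w :
  S w -> (forall i, P i -> S (f i)) ->
  B w (\sum_(i <- r | P i) c i *: f i) = \sum_(i <- r | P i) c i * B w (f i).
Proof.
move=> Sw Sf; rewrite (sipC HB)//; last exact: sip_lincomb.
by rewrite sip_lincombl//; apply: eq_bigr => i Pi; rewrite (sipC HB)//; exact: Sf.
Qed.

Lemma sip_sqrB u v : S u -> S v -> B (u - v) (u - v) = B u u - 2 * B u v + B v v.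
Proof.
move=> Su Sv; have Suv := sipB Su Sv.
by rewrite sipBl// !sipBr// (@sipC HB v u)//; ring.
Qed.

(** The nonnegative quadratic t |-> B(u - t v, u - t v) would be affine in t,
hence constant. *)
Lemma sip_null u v : S u -> S v -> B v v = 0 -> B u v = 0.
Proof.
move=> Su Sv vv0; apply/eqP/negPn/negP => uv0.
(* For this t the quadratic equals -1. *)
pose t := (B u u + 1) / (2 * B u v).
have := sip_ge0 HB (sipB Su (sipZ HB t Sv)).
rewrite sip_sqrB//; last exact: (sipZ HB).
rewrite !sipZr// ?(sipZl HB)//; last exact: (sipZ HB).
rewrite vv0 !mulr0 addr0.
have -> : 2 * (t * B u v) = B u u + 1 by rewrite /t; field; rewrite uv0.
by rewrite opprD addrA subrr sub0r ler0N1.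
Qed.

Lemma sip_amgm u v : S u -> S v -> `|B u v| <= (B u u + B v v) / 2.
Proof.
move=> Su Sv.
have h1 := sip_ge0 HB (sipB Su Sv); rewrite sip_sqrB// in h1.
have := sip_ge0 HB (sipB Su (sipN Sv)); rewrite sip_sqrB//; last exact: sipN.
have SNv := sipN Sv.
rewrite (@sipC HB u (- v))// !sipNl// (@sipC HB v (- v))// sipNl// (@sipC HB v u)// => h2.
rewrite ler_norml; apply/andP; split; lra.
Qed.

(** Induction on the family: project on the span of the first n vectors, then
correct along the component z of the last one orthogonal to them.  If z is a
null vector, it is orthogonal to everything by [sip_null], and then the
coefficient 0/0 = 0 does no harm. *)
Lemma exists_projection (y : nat -> V) n u :
  S u -> (forall k, (k < n)%N -> S (y k)) ->
  exists c : nat -> R,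
    forall k, (k < n)%N -> B (u - \sum_(i < n) c i *: y i) (y k) = 0.
Proof.
elim: n u => [|n IH] u Su Sy; first by exists (fun=> 0).
have Sy' k : (k < n)%N -> S (y k) by move=> kn; apply: Sy; exact: ltnW.
have Syn : S (y n) by exact: Sy.
have [c hc] := IH u Su Sy'; have [c' hc'] := IH (y n) Syn Sy'.
have SP (a : nat -> R) : S (\sum_(i < n) a i *: y i).
  by apply: sip_lincomb => i _; exact: Sy'.
set z := y n - \sum_(i < n) c' i *: y i in hc'.
have Sz : S z by exact: sipB.
pose l := B u z / B z z.
exists (fun i => if i == n then l else c i - l * c' i) => k kn.
have -> : u - \sum_(i < n.+1) (if i == n :> nat then l else c i - l * c' i) *: y i
   = u - \sum_(i < n) c i *: y i - l *: z.
  rewrite big_ord_recr/= eqxx.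
  under eq_bigr => i _ do rewrite (ltn_eqF (ltn_ord i)) scalerBl -scalerA.
  rewrite sumrB -scaler_sumr /z scalerBr -[RHS]addrA -opprD; congr (_ - _).
  by rewrite -addrA; congr (_ + _); rewrite addrC.
have Slz := sipZ HB l Sz.
have Sw : S (u - \sum_(i < n) c i *: y i - l *: z).
  by apply: sipB => //; apply: sipB => //.
have low j : (j < n)%N -> B (u - \sum_(i < n) c i *: y i - l *: z) (y j) = 0.
  move=> jn; rewrite sipBl//; [|exact: sipB|exact: Sy'].
  by rewrite hc// (sipZl HB)// ?hc'// ?mulr0 ?subr0//; exact: Sy'.
move: kn; rewrite ltnS leq_eqVlt => /predU1P[->|]; last exact: low.
have -> : y n = z + \sum_(i < n) c' i *: y i by rewrite /z subrK.
rewrite sipDr// sip_lincombr//; last by move=> i _; exact: Sy'.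
rewrite [X in _ + X]big1; last by move=> i _; rewrite low ?mulr0.
rewrite addr0 !sipBl// ?(sipZl HB)//; last exact: sipB.
rewrite sip_lincombl//; last by move=> i _; exact: Sy'.
rewrite big1; last first.
  by move=> i _; rewrite (sipC HB)// ?hc' ?mulr0//; exact: Sy'.
rewrite subr0 /l; have [zz0|zz0] := eqVneq (B z z) 0.
  by rewrite (sip_null Su Sz zz0) mul0r mul0r subrr.
by rewrite divfK// subrr.
Qed.

(** Gram-Schmidt in which a vector whose component orthogonal to the previous
ones is null is skipped: linear dependence in the family costs nothing, and the
family is recovered up to null vectors. *)
Lemma exists_orthonormal (y : nat -> V) n :
  (forall k, (k < n)%N -> S (y k)) ->
  exists (D : nat) (e : nat -> V),
    [/\ forall b, (b < D)%N -> S (e b),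
        forall a b, (a < D)%N -> (b < D)%N -> B (e a) (e b) = (a == b)%:R &
        forall k, (k < n)%N -> exists m : nat -> R,
          let z := y k - \sum_(b < D) m b *: e b in B z z = 0].
Proof.
elim: n => [|n IH] Sy; first by exists 0%N, (fun=> 0).
have [k kn|D [e [Se eON he]]] := IH; first by apply: Sy; exact: ltnW.
have Syn : S (y n) by exact: Sy.
have SP (a : nat -> R) : S (\sum_(b < D) a b *: e b).
  by apply: sip_lincomb => i _; exact: Se.
pose c b := B (y n) (e b).
set z := y n - \sum_(b < D) c b *: e b.
have Sz : S z by exact: sipB.
have ze b : (b < D)%N -> B z (e b) = 0.
  move=> bD; rewrite sipBl//; last exact: Se.
  rewrite sip_lincombl//; [|exact: Se|by move=> i _; exact: Se].
  rewrite (bigD1 (Ordinal bD))//= eON// eqxx mulr1 big1 ?addr0 ?subrr// => i ib.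
  rewrite eON//; case: eqVneq => [ib'|_]; last by rewrite mulr0.
  by move: ib; rewrite -val_eqE/= ib' eqxx.
have [zz0|zz0] := eqVneq (B z z) 0.
  exists D, e; split => // k; rewrite ltnS leq_eqVlt => /predU1P[->|]; last exact: he.
  by exists c.
have zzgt0 : 0 < B z z by rewrite lt_def zz0 (sip_ge0 HB).
pose s := Num.sqrt (B z z).
have s0 : s != 0 by rewrite gt_eqF// sqrtr_gt0.
pose e' b := if b == D then s^-1 *: z else e b.
have e'lt b : (b < D)%N -> e' b = e b by move=> bD; rewrite /e' ltn_eqF.
have SsZ : S (s^-1 *: z) by exact: (sipZ HB).
exists D.+1, e'; split.
- by move=> b; rewrite ltnS leq_eqVlt /e'; case: eqVneq => //= _; exact: Se.
- move=> a b; rewrite ltnS leq_eqVlt => + /[!ltnS] /[!(leq_eqVlt b)].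
  rewrite /e'; case: (eqVneq a D) => [->|aD] /=; case: (eqVneq b D) => [->|bD] //=.
  + move=> _ _; rewrite (sipZl HB)// sipZr//.
    by rewrite -[B z z](sqr_sqrtr (ltW zzgt0)) -/s expr2 mulKf// mulVf.
  + by move=> _ bD'; rewrite (sipZl HB)// ?ze ?mulr0//; exact: Se.
  + move=> aD' _; rewrite (negbTE aD) (sipC HB)//; last exact: Se.
    by rewrite (sipZl HB)// ?ze ?mulr0//; exact: Se.
  + by move=> aD' bD'; rewrite eON.
- have sume' (m : nat -> R) : \sum_(b < D.+1) m b *: e' b =
      \sum_(b < D) m b *: e b + m D *: (s^-1 *: z).
    rewrite big_ord_recr/= {2}/e' eqxx; congr (_ + _).
    by apply: eq_bigr => b _; rewrite e'lt.
  move=> k; rewrite ltnS leq_eqVlt => /predU1P[->|kn].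
    pose m' b := if b == D then s else c b.
    exists m'; rewrite (sume' m') /m' eqxx.
    rewrite scalerA divff// scale1r.
    under eq_bigr => b _ do rewrite (ltn_eqF (ltn_ord b)).
    by rewrite opprD addrA -/z subrr sip0l//; exact: (sip0 HB).
  have [m hm] := he k kn; pose m' b := if b == D then 0 else m b.
  exists m'; rewrite (sume' m') /m' eqxx scale0r addr0.
  by under eq_bigr => b _ do rewrite (ltn_eqF (ltn_ord b)).
Qed.

(** Schur's test: the Gram matrix of F is block-diagonal for E, with n entries,
each at most K, in a row. *)
Lemma schur_bound (I : finType) (c : I -> R) (F : I -> V) (E : rel I) (K : R) (n : nat) :
  symmetric E -> (forall i, S (F i)) -> (forall i, B (F i) (F i) <= K) ->
  (forall i j, ~~ E i j -> B (F i) (F j) = 0) ->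
  (forall i, \sum_j (E i j)%:R = n%:R :> R) ->
  B (\sum_i c i *: F i) (\sum_i c i *: F i) <= K * n%:R * \sum_i c i ^+ 2.
Proof.
move=> Esym SF FK F0 En.
have SP : S (\sum_i c i *: F i) by apply: sip_lincomb.
rewrite sip_lincombl//.
under eq_bigr => i _ do rewrite sip_lincombr// mulr_sumr.
have bnd i j : c i * (c j * B (F i) (F j)) <=
    K * ((E i j)%:R * c i ^+ 2 + (E j i)%:R * c j ^+ 2) / 2.
  have [Eij|Eij] := boolP (E i j); last first.
    by rewrite F0// Esym (negbTE Eij) !mul0r addr0 !mulr0 mul0r.
  rewrite Esym Eij !mul1r.
  have BK : `|B (F i) (F j)| <= K.
    apply: le_trans (sip_amgm (SF i) (SF j)) _.
    by have := FK i; have := FK j; lra.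
  have K0 : 0 <= K := le_trans (normr_ge0 _) BK.
  rewrite mulrA (le_trans (ler_norm _))// normrM.
  apply: (@le_trans _ _ (`|c i * c j| * K)); first exact: ler_wpM2l.
  rewrite mulrC -mulrA; apply: ler_wpM2l => //.
  rewrite normrM -(real_normK (num_real (c i))) -(real_normK (num_real (c j))).
  have := sqr_ge0 (`|c i| - `|c j|); rewrite sqrrB; lra.
apply: (@le_trans _ _ (\sum_i \sum_j K * ((E i j)%:R * c i ^+ 2 + (E j i)%:R * c j ^+ 2) / 2)).
  by apply: ler_sum => i _; apply: ler_sum => j _; exact: bnd.
rewrite le_eqVlt; apply/orP; left; apply/eqP.
under eq_bigr => i _ do rewrite -mulr_suml -mulr_sumr big_split/=.
rewrite -mulr_suml -mulr_sumr big_split/= [X in _ + X]exchange_big/=.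
under eq_bigr => i _ do rewrite -mulr_suml En.
by rewrite -mulr_sumr; field.
Qed.

(** The projection v is at least as close to u as w is; conclude by Pythagoras. *)
Lemma sip_ge_projection u v w : S u -> S v -> S w ->
  B (u - v) v = 0 -> B (u - v) w = 0 -> B u u - B (u - w) (u - w) <= B v v.
Proof.
move=> Su Sv Sw uv uw.
have e1 : B u v = B v v by apply/eqP; rewrite -subr_eq0 -sipBl// uv.
have e2 : B u w = B v w by apply/eqP; rewrite -subr_eq0 -sipBl// uw.
have := sip_ge0 HB (sipB Sv Sw); rewrite (sip_sqrB Sv Sw) (sip_sqrB Su Sw) e2; lra.
Qed.

End SemiInnerProduct.

(** * Square integrable functions and the subspace angle *)

Section SquareIntegrable.
Context {d : measure_display} {T : measurableType d} {R : realType}.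
Variable mu : {measure set T -> \bar R}.
Implicit Types f g u v : T -> R.

(** The carrier T is fixed by mu, so that P and Q may be stated with the order
and ring structures of a numeric type. *)
Lemma ae_sub (P Q : T -> Prop) : {ae mu, forall x, P x} ->
  (forall x, P x -> Q x) -> {ae mu, forall x, Q x}.
Proof. by move=> aeP PQ; apply: filterS aeP. Qed.

Lemma ae_sub2 (P P' Q : T -> Prop) : {ae mu, forall x, P x} ->
  {ae mu, forall x, P' x} -> (forall x, P x -> P' x -> Q x) ->
  {ae mu, forall x, Q x}.
Proof. by move=> aeP aeP' PQ; apply: filterS2 aeP aeP'. Qed.

Definition sq_integrable f : Prop :=
  measurable_fun setT f /\ mu.-integrable setT (EFin \o (fun x => f x * f x)).

Lemma sq_integrable_Lfun f : f \in Lfun mu 2%:E -> sq_integrable f.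
Proof.
move=> /[dup] /Lfun2_integrable_sqr fi; rewrite inE => /andP[+ _].
by rewrite inE/= => mf; split.
Qed.

Lemma sq_integrable_dominated f g h : sq_integrable g -> sq_integrable h ->
  measurable_fun setT f -> (forall x, `|f x| <= g x * g x + h x * h x) ->
  mu.-integrable setT (EFin \o f).
Proof.
move=> [mg ig] [mh ih] mf fgh.
apply: (le_integrable _ _ _ (integrableD measurableT ig ih)) => //.
  exact/measurable_EFinP.
move=> x _; rewrite lee_fin /=.
by rewrite [leRHS]ger0_norm ?fgh// addr_ge0// -expr2 sqr_ge0.
Qed.

Lemma sq_integrable_mul f g : sq_integrable f -> sq_integrable g ->
  mu.-integrable setT (EFin \o (fun x => f x * g x)).
Proof.
move=> Sf Sg; apply: (sq_integrable_dominated Sf Sg).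
  by apply: measurable_funM; [exact: Sf.1|exact: Sg.1].
move=> x; have := sqr_ge0 (f x - g x); have := sqr_ge0 (f x + g x).
rewrite ler_norml !expr2 => h1 h2; apply/andP; split; nra.
Qed.

Lemma sq_integrableZ a f : sq_integrable f -> sq_integrable (a *: f).
Proof.
move=> [mf fi]; split.
  by apply: measurable_funM => //; exact: measurable_cst.
rewrite (_ : _ \o _ = fun x => ((a * a)%:E * (f x * f x)%:E)%E).
  exact: integrableZl.
by apply/funext => x /=; rewrite -EFinM; congr EFin; rewrite mulrACA.
Qed.

Lemma sq_integrableD f g :
  sq_integrable f -> sq_integrable g -> sq_integrable (f + g).
Proof.
move=> Sf Sg; have mfg : measurable_fun setT (f + g).
  by apply: measurable_funD; [exact: Sf.1|exact: Sg.1].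
split => //; apply: (@sq_integrable_dominated _ (2 *: f) (2 *: g)).
- exact: sq_integrableZ.
- exact: sq_integrableZ.
- exact: measurable_funM.
- move=> x; have -> : (2 *: f) x = 2 * f x by [].
  have -> : (2 *: g) x = 2 * g x by [].
  have -> : (f + g) x = f x + g x by [].
  rewrite ger0_norm -?expr2 ?sqr_ge0//; have := sqr_ge0 (f x - g x).
  by rewrite !expr2 => h; nra.
Qed.

Lemma sq_integrable0 : sq_integrable 0.
Proof.
split; first exact: measurable_cst.
rewrite (_ : _ \o _ = cst 0%E); first exact: integrable0.
by apply/funext => x /=; rewrite mulr0.
Qed.

Lemma sip_dotp : semi_inner_product sq_integrable (dotp mu).
Proof.
split.
- exact: sq_integrable0.
- exact: sq_integrableD.
- exact: sq_integrableZ.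
- by move=> u v _ _; apply: eq_Rintegral => x _; rewrite mulrC.
- move=> u v w Su Sv Sw; rewrite /dotp -RintegralD//; try exact: sq_integrable_mul.
  by apply: eq_Rintegral => x _; rewrite -mulrDl.
- move=> a u v Su Sv; rewrite /dotp -RintegralZl//; last exact: sq_integrable_mul.
  by apply: eq_Rintegral => x _; rewrite mulrA.
- by move=> u _; apply: Rintegral_ge0 => x _; rewrite -expr2 sqr_ge0.
Qed.

Lemma dotp_EFin f g : sq_integrable f -> sq_integrable g ->
  (dotp mu f g)%:E = (\int[mu]_x (f x * g x)%:E)%E.
Proof.
move=> Sf Sg; rewrite fineK//; apply: integrable_fin_num => //.
exact: sq_integrable_mul.
Qed.

Lemma Lnorm2_dotp f : sq_integrable f ->
  ('N[mu]_2%:E[EFin \o f] = (Num.sqrt (dotp mu f f))%:E)%E.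
Proof.
move=> Sf; rewrite unlock /Lnorm.
under eq_integral => x _ do rewrite /= powR_mulrn// real_normK ?num_real// expr2.
rewrite -dotp_EFin// poweR_EFin powR12_sqrt//.
exact: (sip_ge0 sip_dotp).
Qed.

Lemma dotp_null_ae f : sq_integrable f -> dotp mu f f = 0 ->
  {ae mu, forall x, f x = 0}.
Proof.
move=> Sf f0.
have : (\int[mu]_x `|(f x * f x)%:E| = 0)%E.
  under eq_integral => x _ do rewrite gee0_abs ?lee_fin -?expr2 ?sqr_ge0//.
  by rewrite -[RHS]/(0%:E) -f0 dotp_EFin//; apply: eq_integral => x _; rewrite expr2.
have mff : measurable_fun setT (EFin \o (fun x => f x * f x)).
  by case: Sf => mf /integrableP[].
move=> /(ae_eq_integral_abs mu measurableT mff); apply: filterS => x /(_ I) /=.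
by case=> /eqP; rewrite mulf_eq0 orbb => /eqP.
Qed.

Lemma sq_integrable_ae f g : measurable_fun setT g ->
  {ae mu, forall x, f x = g x} -> sq_integrable f -> sq_integrable g.
Proof.
move=> mg fg [mf fi]; split => //.
have mgg : measurable_fun setT (EFin \o (fun x => g x * g x)).
  by apply/measurable_EFinP; exact: measurable_funM.
apply/integrableP; split => //.
case/integrableP: fi => mff; apply: le_lt_trans.
rewrite (@ge0_ae_eq_integral _ _ _ mu setT _
  (fun x => `|(f x * f x)%:E|%E))//.
- exact: measurableT_comp.
- exact: measurableT_comp.
- by apply: filterS fg => x fgx _ /=; rewrite fgx.
Qed.

Lemma dotp_ae f f' g g' : sq_integrable f -> sq_integrable f' ->
  sq_integrable g -> sq_integrable g' ->
  {ae mu, forall x, f x = f' x} -> {ae mu, forall x, g x = g' x} ->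
  dotp mu f g = dotp mu f' g'.
Proof.
move=> Sf Sf' Sg Sg' ff gg; congr fine; apply: ae_eq_integral => //.
- by case/integrableP: (sq_integrable_mul Sf Sg).
- by case/integrableP: (sq_integrable_mul Sf' Sg').
- apply: filterS2 ff gg => x ffx ggx _.
  by rewrite ffx ggx.
Qed.

(** Any v in W with u - v orthogonal to W satisfies
|v|^2 >= |u|^2 - |u - w|^2 for each w in W. *)
Lemma subspace_angle_le (U W : set (T -> R)) (theta : R) :
  1 < theta -> (forall u, U u -> sq_integrable u) ->
  (forall w, W w -> sq_integrable w) ->
  (forall u, sq_integrable u -> exists v, W v /\
    forall w, W w -> dotp mu (u - v) w = 0) ->
  (forall u, U u -> dotp mu u u = 1 ->
     exists2 w, W w & dotp mu (u - w) (u - w) <= 1 - theta ^- 2) ->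
  (subspace_angle mu U W <= theta%:E)%E.
Proof.
move=> theta1 SU SW projW nearW.
have theta0 : 0 < theta by apply: lt_trans theta1.
have lb : ((theta^-1)%:E <= ereal_inf [set 'N[mu]_2%:E[EFin \o orth_proj mu W u]
    | u in [set u | U u /\ 'N[mu]_2%:E[EFin \o u] = 1]])%E.
  apply: le_ereal_inf_tmp => _ [u [Uu u1] <-].
  have Su := SU u Uu.
  have uu1 : dotp mu u u = 1.
    move: u1; rewrite Lnorm2_dotp// => -[] /(congr1 (fun x => x ^+ 2)).
    by rewrite sqr_sqrtr ?expr1n//; exact: (sip_ge0 sip_dotp).
  have [Pu uP] : [set v | W v /\ forall w, W w ->
       dotp mu (fun x => u x - v x) w = 0] (orth_proj mu W u).
    by apply: xgetPex; exact: projW.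
  have [w Ww uw] := nearW u Uu uu1.
  have SP := SW _ Pu; have Sw := SW _ Ww.
  rewrite Lnorm2_dotp// lee_fin -(@ler_pXn2r _ 2) ?nnegrE ?sqrtr_ge0//; last first.
    by rewrite invr_ge0 ltW.
  rewrite sqr_sqrtr; last exact: (sip_ge0 sip_dotp).
  have := sip_ge_projection sip_dotp Su SP Sw (uP _ Pu) (uP _ Ww).
  rewrite exprVn uu1; lra.
rewrite /subspace_angle; case: (ereal_inf _) lb => [r| |] //.
- rewrite lee_fin => lb; have r0 : 0 < r by apply: lt_le_trans lb; rewrite invr_gt0.
  by rewrite inver gt_eqF// lee_fin -[theta]invrK lef_pV2// ?posrE// invr_gt0.
- by move=> _; rewrite invey lee_fin ltW.
Qed.

End SquareIntegrable.

(** * Lebesgue measure and affine maps *)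

Section AffineLebesgue.
Context {R : realType}.
Local Notation RM := (measurableTypeR R).
Local Notation leb := (@lebesgue_measure R).

Definition affine (a b : R) : RM -> RM := fun x => a * x + b.

Lemma measurable_affine a b : measurable_fun setT (affine a b).
Proof. by apply: measurable_funD => //; exact: measurable_funM. Qed.

(** Both sides are measures that agree on half-open intervals.  The sign of a
decides which end of the preimage is closed. *)
Lemma lebesgue_measure_affine a b (A : set RM) : a != 0 -> measurable A ->
  leb A = (`|a|%:E * leb (affine a b @^-1` A))%E.
Proof.
move=> a0 mA.
pose m := measure_function_pushforward__canonical__measure_function_Measure
  leb (measurable_affine a b).
apply: (@lebesgue_measure_unique R (mscale (`|a|%:nng) m)) => // _ [[l u] _ <-] /=.
rewrite /mscale/= /pushforward/= lebesgue_measure_itv/= lte_fin.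
have [ap|an] : 0 < a \/ a < 0 by case: (ltrgtP a 0) a0 => //; [right|left].
- have -> : affine a b @^-1` `]l, u]%classic = `](l - b) / a, (u - b) / a]%classic.
    apply/seteqP; split => x /=; rewrite !in_itv/= /affine.
      by rewrite ltr_pdivrMr// ler_pdivlMr// ltrBlDr lerBrDr mulrC.
    by rewrite ltr_pdivrMr// ler_pdivlMr// ltrBlDr lerBrDr mulrC.
  rewrite lebesgue_measure_itv/= lte_fin ltr_pM2r ?invr_gt0// ltrD2r.
  case: ifPn => _; last by rewrite mule0.
  by rewrite -!EFinB -EFinM gtr0_norm//; congr EFin; field.
- have -> : affine a b @^-1` `]l, u]%classic = `[(u - b) / a, (l - b) / a[%classic.
    apply/seteqP; split => x /=; rewrite !in_itv/= /affine.
      by rewrite ltr_ndivlMr// ler_ndivrMr// ltrBlDr lerBrDr mulrC andbC.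
    by rewrite ltr_ndivlMr// ler_ndivrMr// ltrBlDr lerBrDr mulrC andbC.
  rewrite lebesgue_measure_itv/= lte_fin ltr_nM2r ?invr_lt0// ltrD2r.
  case: ifPn => _; last by rewrite mule0.
  by rewrite -!EFinB -EFinM ltr0_norm//; congr EFin; field.
Qed.

Lemma ae_affine a b (P : RM -> Prop) : a != 0 ->
  {ae leb, forall x, P x} -> {ae leb, forall x, P (affine a b x)}.
Proof.
move=> a0 [N [mN N0 PN]]; exists (affine a b @^-1` N); split.
- by rewrite -[X in measurable X]setTI; exact: measurable_affine.
- have := lebesgue_measure_affine b a0 mN; rewrite N0.
  move/esym/eqP; rewrite mule_eq0 eqe normr_eq0 (negbTE a0)/= => /eqP.
  by [].
- by move=> x nP; apply: PN.
Qed.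

Lemma ge0_integral_affine a b (f : RM -> R) : a != 0 ->
  measurable_fun setT f -> (forall x, 0 <= f x) ->
  (\int[leb]_x (f x)%:E = `|a|%:E * \int[leb]_x (f (affine a b x))%:E)%E.
Proof.
move=> a0 mf f0.
pose m := measure_function_pushforward__canonical__measure_function_Measure
  leb (measurable_affine a b).
have mf' : measurable_fun setT (fun x : RM => (f x)%:E) by exact/measurable_EFinP.
rewrite (eq_measure_integral (mscale (`|a|%:nng) m)); last first.
  by move=> A mA _; exact: (lebesgue_measure_affine b a0 mA).
rewrite ge0_integral_mscale//=; last by move=> x _; rewrite lee_fin.
rewrite (ge0_integral_pushforward (measurable_affine a b))// => x _.
by rewrite lee_fin.
Qed.

Lemma sq_integrable_affine a b (f : RM -> R) : a != 0 ->
  sq_integrable leb f -> sq_integrable leb (f \o affine a b).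
Proof.
move=> a0 [mf fi].
have mfa : measurable_fun setT (f \o affine a b).
  by apply: measurableT_comp => //; exact: measurable_affine.
split => //; apply/integrableP; split.
  by apply/measurable_EFinP; exact: measurable_funM.
case/integrableP: fi => _ /=.
under eq_integral => x _ do rewrite -expr2 ger0_norm ?sqr_ge0//.
under [in X in _ -> X]eq_integral => x _ do rewrite -expr2 ger0_norm ?sqr_ge0//.
rewrite (@ge0_integral_affine a b _ a0)//; last 2 first.
- exact: measurable_funX.
- by move=> x; rewrite sqr_ge0.
move=> h; rewrite ltNge leye_eq; apply/negP => /eqP e; move: h.
by rewrite e gt0_muley ?lte_fin ?normr_gt0// ltxx.
Qed.

Lemma dotp_affine a b (f : RM -> R) : a != 0 -> sq_integrable leb f ->
  dotp leb f f = `|a| * dotp leb (f \o affine a b) (f \o affine a b).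
Proof.
move=> a0 Sf; have Sfa := sq_integrable_affine b a0 Sf.
apply: EFin_inj; rewrite EFinM !dotp_EFin//.
apply: (@ge0_integral_affine a b (fun x => f x * f x) a0).
  by apply: measurable_funM; exact: Sf.1.
by move=> x; rewrite -expr2 sqr_ge0.
Qed.

Lemma ae_leb01 (P : RM -> Prop) :
  {ae leb, forall x, `[0, 1]%classic x -> P x} <-> {ae @leb01 R, forall x, P x}.
Proof.
have m01 : measurable (`[0, 1]%classic : set RM) by exact: measurable_itv.
split=> -[N [mN N0 PN]].
- exists (N `|` ~` `[0, 1]%classic); split.
  + by apply: measurableU => //; exact: measurableC.
  + rewrite /leb01 /mrestr setIUl setICl setU0; apply: subset_measure0 N0 => //.
    exact: measurableI.
  + move=> x /= nP; have [x01|x01] := pselect (`[0, 1]%classic x); last by right.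
    by left; apply: PN => /= h; apply: nP; exact: h.
- exists (N `&` `[0, 1]%classic); split => //; first exact: measurableI.
  move=> x /= nP; have [x01|x01] := pselect (`[0, 1]%classic x); last first.
    by exfalso; apply: nP.
  by split => //; apply: PN => /= h; apply: nP.
Qed.

Lemma ae_leb01_in : {ae @leb01 R, forall x, 0 <= x < 1}.
Proof.
apply/ae_leb01; exists [set 1]; split => //; first exact: lebesgue_measure_set1.
move=> x /= /not_implyP[]; rewrite in_itv/= => /andP[-> x1] /negP.
by rewrite /= -leNgt => x1'; apply/eqP; rewrite eq_le x1.
Qed.

Lemma ge0_integral_leb01 (f : RM -> R) : measurable_fun setT f ->
  (forall x, 0 <= f x) ->
  (\int[@leb01 R]_x (f x)%:E = \int[leb]_(x in `[0%R, 1%R]) (f x)%:E)%E.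
Proof.
move=> mf f0; have m01 : measurable (`[0, 1]%classic : set RM) by exact: measurable_itv.
rewrite (@ge0_negligible_integral _ _ _ (@leb01 R) setT (~` `[0, 1]%classic)) => //.
- rewrite setTD setCK; apply: eq_measure_integral => A mA A01.
  by congr (lebesgue_measure _); apply/setIidl.
- exact: measurableC.
- exact/measurable_EFinP.
- by move=> x _; rewrite lee_fin.
- transitivity (leb set0); last exact: measure0.
  by congr (lebesgue_measure _); exact: setICl.
Qed.

Lemma sq_integrable_leb01 (f : RM -> R) :
  sq_integrable leb f -> sq_integrable (@leb01 R) f.
Proof.
move=> [mf fi]; split => //; apply/integrableP; split.
  by apply/measurable_EFinP; exact: measurable_funM.
case/integrableP: fi => _; apply: le_lt_trans => /=.
rewrite ge0_integral_leb01//; last exact/measurableT_comp/measurable_funM.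
apply: ge0_subset_integral => //; apply/measurable_EFinP/measurableT_comp => //.
exact: measurable_funM.
Qed.

Lemma integral_leb01_vanishing (f : RM -> R) : measurable_fun setT f ->
  (forall x, 0 <= f x) -> (forall x, ~ `[0, 1]%classic x -> f x = 0) ->
  (\int[@leb01 R]_x (f x)%:E = \int[leb]_x (f x)%:E)%E.
Proof.
move=> mf f0 fz; rewrite ge0_integral_leb01// integral_mkcond.
apply: eq_integral => x _; rewrite /patch; case: ifPn => // /negP.
by rewrite inE => /fz ->.
Qed.

Lemma sq_integrable_vanishing (f : RM -> R) :
  (forall x, ~ `[0, 1]%classic x -> f x = 0) ->
  sq_integrable (@leb01 R) f -> sq_integrable leb f.
Proof.
move=> fz [mf fi]; split => //; apply/integrableP; split.
  by apply/measurable_EFinP; exact: measurable_funM.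
case/integrableP: fi => _ /=; rewrite integral_leb01_vanishing//.
- exact/measurableT_comp/measurable_funM.
- by move=> x /fz ->; rewrite mul0r normr0.
Qed.

Lemma dotp_vanishing (f : RM -> R) :
  (forall x, ~ `[0, 1]%classic x -> f x = 0) ->
  sq_integrable leb f -> dotp (@leb01 R) f f = dotp leb f f.
Proof.
move=> fz Sf; have Sf01 := sq_integrable_leb01 Sf.
apply: EFin_inj; rewrite !dotp_EFin//.
apply: integral_leb01_vanishing.
- by apply: measurable_funM; exact: Sf.1.
- by move=> x; rewrite -expr2 sqr_ge0.
- by move=> x /fz ->; rewrite mul0r.
Qed.

End AffineLebesgue.

(** * Density of dyadic step functions *)

Section DominatedL2.
Context {d : measure_display} {T : measurableType d} {R : realType}.

(** Dominated convergence for the squares. *)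
Lemma dotp_near0 (mu : {measure set T -> \bar R}) (u : nat -> T -> R) (G : T -> R)
    (e : R) : 0 < e ->
  (forall n, measurable_fun setT (u n)) -> sq_integrable mu G ->
  {ae mu, forall x, forall n, `|u n x| <= `|G x|} ->
  {ae mu, forall x, u ^~ x @ \oo --> (0 : R)} ->
  \forall n \near \oo, dotp mu (u n) (u n) <= e.
Proof.
move=> e0 mu_ [mG iG] uG u0.
have [] := @dominated_convergence _ _ _ mu setT measurableT
  (fun n x => (u n x * u n x)%:E) (cst 0%E) (fun x => (G x * G x)%:E).
- by move=> n; apply/measurable_EFinP; exact: measurable_funM.
- exact: measurable_cst.
- apply: filterS u0 => x ux _; apply/cvg_EFin; first exact: nearW.
  by have := @cvgM _ _ _ _ _ _ _ _ ux ux; rewrite mulr0; apply.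
- exact: iG.
- apply: filterS uG => x ux n _ /=.
  by rewrite lee_fin normrM -[leRHS]ger0_norm -?expr2 ?sqr_ge0// normrX expr2 ler_pM.
move=> _ _; rewrite integral0 => /fine_cvgP[_] /cvgrPdist_le /(_ e e0).
by apply: filterS => n; rewrite sub0r normrN => /(le_trans (ler_norm _)).
Qed.

Lemma sq_integrable_bounded (mu : {finite_measure set T -> \bar R}) (f : T -> R)
    (M : R) : measurable_fun setT f -> {ae mu, forall x, `|f x| <= M} ->
  sq_integrable mu f.
Proof.
move=> mf fM; split => //; apply/integrableP; split.
  by apply/measurable_EFinP; exact: measurable_funM.
apply: (@le_lt_trans _ _ (\int[mu]_x (cst (M ^+ 2)%:E x))%E).
  apply: ae_ge0_le_integral => //.
  - by apply: measurableT_comp => //; apply/measurable_EFinP; exact: measurable_funM.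
  - by move=> x _; rewrite lee_fin sqr_ge0.
  - apply: filterS fM => x fx _ /=.
    by rewrite lee_fin normrM -expr2 lerXn2r// ?nnegrE// (le_trans _ fx).
rewrite integral_cst//= lte_mul_pinfty// ?lee_fin ?sqr_ge0//.
by rewrite ltey_eq fin_num_measure.
Qed.

Lemma sq_norm_add_le (mu : {measure set T -> \bar R}) (f g : T -> R) :
  sq_integrable mu f -> sq_integrable mu g ->
  dotp mu (f + g) (f + g) <= 2 * dotp mu f f + 2 * dotp mu g g.
Proof.
move=> Sf Sg; have HB := sip_dotp mu.
have := sip_ge0 HB (sipB HB Sf Sg).
rewrite (sip_sqrB HB Sf Sg).
have Sfg := sq_integrableD Sf Sg.
rewrite (sipDl HB)// !(sipDr HB)// (sipC HB Sg Sf); lra.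
Qed.

End DominatedL2.

Section DyadicDensity.
Context {R : realType}.
Local Notation RM := (measurableTypeR R).
Local Notation leb := (@lebesgue_measure R).

Definition dyadic_step (j : nat) (A : nat -> R) : RM -> R :=
  fun x => A (Num.truncn (2 ^+ j * x)).

Lemma measurable_truncn : measurable_fun setT (fun x : RM => Num.truncn x).
Proof.
have le n : measurable [set x : RM | (Num.truncn x <= n)%N].
  have -> : [set x : RM | (Num.truncn x <= n)%N] = `]-oo, n.+1%:R[%classic.
    by apply/seteqP; split=> x /=; rewrite in_itv/= truncn_le_nat.
  exact: measurable_itv.
move=> _ Y _; rewrite setTI.
have -> : (fun x : RM => Num.truncn x) @^-1` Y =
    \bigcup_(n in Y) [set x : RM | Num.truncn x = n].
  by apply/seteqP; split => [x Yx|x [n Yn /= xn]]; [exists (Num.truncn x)|rewrite /= xn].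
apply: bigcup_measurable => -[|n] _.
  have -> : [set x : RM | Num.truncn x = 0%N] = [set x : RM | (Num.truncn x <= 0)%N].
    by apply/seteqP; split=> x /=; [move=> ->|rewrite leqn0 => /eqP].
  exact: le.
have -> : [set x : RM | Num.truncn x = n.+1] =
    [set x : RM | (Num.truncn x <= n.+1)%N] `\` [set x : RM | (Num.truncn x <= n)%N].
  apply/seteqP; split=> x /=; first by move=> ->; split => //; rewrite ltnn.
  by move=> [h1 /negP]; rewrite -ltnNge => h2; apply/eqP; rewrite eqn_leq h1.
exact: measurableD.
Qed.

Lemma measurable_dyadic_step j A : measurable_fun setT (dyadic_step j A).
Proof.
apply: (@measurableT_comp _ _ _ _ _ _ A) => //.
apply: (measurableT_comp measurable_truncn).
exact: measurable_funM.
Qed.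

Lemma truncn_dyadic_lt j (x : R) : 0 <= x < 1 -> (Num.truncn (2 ^+ j * x) < 2 ^ j)%N.
Proof.
move=> /andP[x0 x1]; rewrite truncn_lt_nat ?mulr_ge0 ?exprn_ge0// natrX.
by rewrite gtr_pMr// exprn_gt0.
Qed.

Lemma sq_integrable_dyadic_step j A : sq_integrable (@leb01 R) (dyadic_step j A).
Proof.
apply: (@sq_integrable_bounded _ _ _ _ _ (\sum_(q < 2 ^ j) `|A q|)).
  exact: measurable_dyadic_step.
apply: (ae_sub ae_leb01_in) => x /(truncn_dyadic_lt j) xj.
by rewrite /dyadic_step (bigD1 (Ordinal xj))//= lerDl sumr_ge0.
Qed.

Let clip (n : R) (y : R) := Num.max (- n) (Num.min n y).

Let clip_bound n y : 0 <= n -> `|clip n y| <= n.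
Proof.
move=> n0; rewrite /clip ler_norml le_max lexx/= ge_max ge_min lexx andbT.
by rewrite (le_trans _ n0)// oppr_le0.
Qed.

Let clip_id n y : `|y| <= n -> clip n y = y.
Proof.
rewrite ler_norml => /andP[h1 h2]; rewrite /clip (min_idPr h2).
by apply/max_idPr.
Qed.

Let clip_lip n y z : 0 <= n -> `|clip n y - clip n z| <= `|y - z|.
Proof.
move=> n0; have := ler_norm (y - z); have := ler_norm (z - y).
rewrite (distrC z) => h1 h2.
rewrite /clip /Num.max /Num.min; do ?case: ifPn => //; rewrite -?leNgt => *;
  rewrite ler_norml; apply/andP; split; lra.
Qed.

Let clip_err n y : 0 <= n -> `|y - clip n y| <= `|y|.
Proof.
move=> n0; have := ler_norm y; have := ler_norm (- y); rewrite normrN => h1 h2.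
rewrite /clip /Num.max /Num.min; do ?case: ifPn => //; rewrite -?leNgt => *;
  rewrite ler_norml; apply/andP; split; lra.
Qed.

Let measurable_clip n (f : RM -> R) : measurable_fun setT f ->
  measurable_fun setT (clip n \o f).
Proof.
move=> mf; apply: measurable_maxr; first exact: measurable_cst.
by apply: measurable_minr => //; exact: measurable_cst.
Qed.

Let approx_clip (f : RM -> R) (e : R) : 0 < e -> sq_integrable (@leb01 R) f ->
  exists n : nat, dotp (@leb01 R) (f - (clip n%:R \o f)) (f - (clip n%:R \o f)) <= e.
Proof.
move=> e0 Sf; have mf := Sf.1.
have : \forall n \near \oo,
    dotp (@leb01 R) (f - (clip n%:R \o f)) (f - (clip n%:R \o f)) <= e.
  apply: (@dotp_near0 _ _ _ (@leb01 R) (fun n : nat => f - (clip n%:R \o f)) f e e0) => //.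
  - by move=> n; apply: measurable_funB; [exact: mf|exact: measurable_clip].
  - by apply: nearW => x n; exact: clip_err.
  - apply: nearW => x; apply/cvgrPdist_le => eps eps0.
    exists (Num.truncn `|f x|).+1 => // n /= xn.
    rewrite -[_ x]/(f x - clip n%:R (f x)) clip_id ?subrr ?normr0 ?ltW//.
    by rewrite (lt_le_trans (truncnS_gt _))// ler_nat.
by case=> n _ /(_ n (leqnn n)); exists n.
Qed.

Let approx_cont (f : RM -> R) (M e : R) : 0 < e -> 0 < M ->
  measurable_fun setT f -> (forall x, `|f x| <= M) ->
  exists h : R -> R, [/\ continuous h, forall x, `|h x| <= M &
    dotp (@leb01 R) (f - h) (f - h) <= e].
Proof.
move=> e0 M0 mf fM.
have m01 : measurable (`[0, 1]%classic : set RM) by exact: measurable_itv.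
have l01 : leb `[0, 1]%classic = 1%E.
  by rewrite lebesgue_measure_itv/= lte01 oppr0 adde0.
have fi : leb.-integrable `[0, 1] (EFin \o f).
  apply: measurable_bounded_integrable => //=.
  - by rewrite [X in (X < _)%E]l01 ltry.
  - exact: measurable_funTS.
  - exists M; split; first exact: num_real.
    by move=> y My x _ /=; rewrite (le_trans (fM x))// ltW.
have [g [gc gi glim]] := approximation_continuous_integrable m01
  ltac:(by rewrite [X in (X < _)%E]l01 ltry) fi.
have e2 : 0 < e / (2 * M) by rewrite divr_gt0// mulr_gt0.
move/fine_cvgP : glim => [gfin] /cvgrPdist_lt /(_ _ e2) glim.
have [n []] := filter_ex (filterI gfin glim) => {}gfin {glim}/=.
rewrite sub0r normrN => /(le_lt_trans (ler_norm _)) glim.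
have cc : continuous (clip M).
  move=> x; apply: (@continuous_max R R (cst (- M)) (fun y => Num.min M y)).
    exact: cst_continuous.
  by apply: continuous_min; [exact: cst_continuous|exact: cvg_id].
exists (clip M \o g n); split.
- by move=> x; apply: continuous_comp; [exact: gc|exact: cc].
- by move=> x; apply: clip_bound; exact: ltW.
have mg : measurable_fun setT (g n : RM -> R) by exact: continuous_measurable_fun.
have mc := measurable_clip M mg.
have mfc : measurable_fun setT (f - (clip M \o g n)) by exact: measurable_funB.
have Sfc : sq_integrable (@leb01 R) (f - (clip M \o g n)).
  apply: (@sq_integrable_bounded _ _ _ _ _ (M + M)) => //.
  apply: nearW => x; rewrite -[_ x]/(f x - clip M (g n x)).
  by rewrite (le_trans (ler_normB _ _))// lerD// clip_bound// ltW.
rewrite -lee_fin dotp_EFin//.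
have mfg : measurable_fun setT (fun x : RM => `|f x - g n x|).
  by apply: measurableT_comp => //; exact: measurable_funB.
rewrite (@ge0_integral_leb01 _ 
  (fun x => (f - (clip M \o g n)) x * (f - (clip M \o g n)) x)); last 2 first.
- exact: measurable_funM.
- by move=> x; rewrite -expr2 sqr_ge0.
apply: (@le_trans _ _ (\int[leb]_(x in `[0%R, 1%R]) ((2 * M)%:E * `|(f x - g n x)%:E|))%E).
  apply: ge0_le_integral => //.
  - by move=> x _; rewrite lee_fin -expr2 sqr_ge0.
  - by apply/measurable_EFinP/measurable_funTS; exact: measurable_funM.
  - apply: measurable_funeM; apply: measurable_funTS.
    by apply/measurable_EFinP.
  - move=> x _; rewrite -[X in (X <= _)%E]/((f x - clip M (g n x)) * (f x - clip M (g n x)))%:E.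
    rewrite /= -EFinM lee_fin -expr2 -(real_normK (num_real _)) expr2.
    apply: ler_pM => //.
      rewrite (le_trans (ler_normB _ _))// mulr2n mulrDl mul1r lerD//.
      by rewrite clip_bound// ltW.
    by rewrite -{1}(clip_id (fM x)) clip_lip// ltW.
rewrite ge0_integralZl//=; last 2 first.
- by apply: measurable_funTS; apply/measurable_EFinP.
- by rewrite lee_fin mulr_ge0// ltW.
rewrite -[X in (_ * X)%E]fineK// -EFinM lee_fin mulrC -ler_pdivlMr ?mulr_gt0//.
exact: ltW.
Qed.

Let approx_step (h : R -> R) (M e : R) : 0 < e -> continuous h ->
  (forall x, `|h x| <= M) ->
  \forall j \near \oo, let g := dyadic_step j (fun q => h (q%:R / 2 ^+ j)) in
    dotp (@leb01 R) (h - g) (h - g) <= e.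
Proof.
move=> e0 hc hM.
have mh : measurable_fun setT (h : RM -> R) by exact: continuous_measurable_fun.
apply: (@dotp_near0 _ _ _ (@leb01 R) (fun j => h - dyadic_step j (fun q => h (q%:R / 2 ^+ j)))
   (cst (M + M)) e e0).
- by move=> j; apply: measurable_funB => //; exact: measurable_dyadic_step.
- by apply: (@sq_integrable_bounded _ _ _ _ _ `|M + M|) => //; apply: nearW.
- apply: nearW => x j; rewrite (le_trans _ (ler_norm _))//.
  by rewrite (le_trans (ler_normB _ _))// lerD// /dyadic_step.
apply: (ae_sub ae_leb01_in) => x /andP[x0 x1].
rewrite -[X in _ --> X](subrr (h x)).
apply: cvgB; first exact: cvg_cst.
apply: (cvg_comp (fun j => (Num.truncn (2 ^+ j * x))%:R / 2 ^+ j : R) h); last exact: hc.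
apply/cvgrPdist_le => eps eps0.
have : (fun n : nat => (1 / 2 : R) ^+ n) @ \oo --> (0 : R).
  by apply: cvg_expr; rewrite ger0_norm; lra.
move/cvgrPdist_le => /(_ eps eps0); apply: filterS => j.
rewrite sub0r normrN => jeps; apply: le_trans jeps.
have p0 : 0 < (2 : R) ^+ j by rewrite exprn_gt0.
have /andP[] := truncn_itv (mulr_ge0 (ltW p0) x0).
rewrite mulrC => l1 l2.
have d0 : (Num.truncn (x * 2 ^+ j))%:R / 2 ^+ j <= x by rewrite ler_pdivrMr.
rewrite ger0_norm ?subr_ge0//.
rewrite ger0_norm ?exprn_ge0 ?divr_ge0//.
rewrite div1r exprVn lerBlDr -[X in X + _]mul1r -mulrDl ler_pdivlMr//.
by rewrite addrC natr1 ltW.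
Qed.

(** Truncate f, approximate the truncation by a continuous function h in L1 - which
for functions bounded by M controls the L2 distance up to a factor 2M - and
sample h at the left ends of the dyadic intervals. *)
Lemma dyadic_step_dense (f : RM -> R) (e : R) : 0 < e ->
  sq_integrable (@leb01 R) f ->
  \forall j \near \oo, exists A : nat -> R,
    dotp (@leb01 R) (f - dyadic_step j A) (f - dyadic_step j A) <= e.
Proof.
move=> e0 Sf; have e10 : 0 < e / 10 by rewrite divr_gt0.
have [n fn] := approx_clip e10 Sf.
have M0 : 0 < n%:R + 1 :> R by rewrite ltr_wpDl.
have mfn : measurable_fun setT (clip n%:R \o f) by exact: (measurable_clip _ Sf.1).
have fnM x : `|(clip n%:R \o f) x| <= n%:R + 1.
  by rewrite (le_trans (clip_bound _ _))// lerDl.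
have [h [hc hM fh]] := approx_cont e10 M0 mfn fnM.
have mh : measurable_fun setT (h : RM -> R) by exact: continuous_measurable_fun.
have Sh : sq_integrable (@leb01 R) (h : RM -> R).
  by apply: (sq_integrable_bounded mh); apply: nearW => x; exact: hM.
have Sfn : sq_integrable (@leb01 R) (clip n%:R \o f).
  by apply: (sq_integrable_bounded mfn); apply: nearW => x; exact: fnM.
have := approx_step e10 hc hM; apply: filterS => j hj.
exists (fun q => h (q%:R / 2 ^+ j)); set g := dyadic_step _ _ in hj *.
have Sg : sq_integrable (@leb01 R) g by exact: sq_integrable_dyadic_step.
have HB := sip_dotp (@leb01 R).
have -> : f - g = (f - (clip n%:R \o f)) + (((clip n%:R \o f) - h) + (h - g)).
  by apply/funext => x; rewrite !fctE; ring.
have S1 := sipB HB Sf Sfn; have S2 := sipB HB Sfn Sh; have S3 := sipB HB Sh Sg.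
have := sq_norm_add_le S1 (sq_integrableD S2 S3); have := sq_norm_add_le S2 S3.
lra.
Qed.

End DyadicDensity.

(** * Walsh functions span the dyadic step functions *)

Section WalshSteps.
Context {R : realType}.
Implicit Types (x y : R) (k s n : nat).

Lemma bin_digit_small s i : (s < 2 ^ i)%N -> bin_digit s i = 0%N.
Proof. by move=> si; rewrite /bin_digit divn_small. Qed.

Lemma wal_widen n s x : (s < 2 ^ n)%N ->
  wal s x = (-1) ^+ (\sum_(i < n)
    bin_digit s i * (dyadic_digit x i.+1 + dyadic_digit x i))%N.
Proof.
move=> sn; rewrite /wal; congr (_ ^+ _).
pose F i := (bin_digit s i * (dyadic_digit x i.+1 + dyadic_digit x i))%N.
have stop m : (s < 2 ^ m)%N -> (m <= s + n)%N ->
    (\sum_(i < m) F i = \sum_(i < s + n) F i)%N.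
  move=> sm /subnKC <-; rewrite big_split_ord/= [X in (_ + X)%N]big1 ?addn0// => i _.
  by rewrite /F bin_digit_small// (leq_trans sm)// leq_exp2l// leq_addr.
have h1 := stop s (ltn_expl s (isT : (1 < 2)%N)) (leq_addr n s).
have h2 := stop n sn (leq_addl s n).
exact: etrans h1 (esym h2).
Qed.

(** The digits of 2^k + s are those of s and a 1 in position k. *)
Lemma wal_addn k s x : (s < 2 ^ k)%N ->
  wal (2 ^ k + s) x = wal s x * (-1) ^+ (dyadic_digit x k.+1 + dyadic_digit x k).
Proof.
move=> sk; rewrite (wal_widen x sk) (@wal_widen k.+1); last first.
  by rewrite expnS mul2n -addnn ltn_add2l.
rewrite big_ord_recr/= exprD; congr (_ ^+ _ * _ ^+ _).
  apply: eq_bigr => i _; congr (_ * _)%N; rewrite /bin_digit divnDl; last first.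
    by rewrite dvdn_exp2l// ltnW.
  rewrite oddD -[X in (2 ^ X %/ _)%N](subnK (ltnW (ltn_ord i))) expnD mulnK ?expn_gt0//.
  by rewrite oddX subn_eq0 leqNgt ltn_ord.
by rewrite /bin_digit divnDl ?dvdnn// divnn expn_gt0/= divn_small// mul1n.
Qed.

Lemma truncn_double x : 0 <= x -> (Num.truncn (2 * x))./2 = Num.truncn x.
Proof.
move=> x0; have /andP[l u] := truncn_itv x0; set t := Num.truncn x in l u *.
have x20 : 0 <= 2 * x by rewrite mulr_ge0.
have h1 : (t.*2 <= Num.truncn (2 * x))%N.
  by rewrite truncn_ge_nat// -mul2n natrM ler_pM2l.
have h2 : (Num.truncn (2 * x) < t.+1.*2)%N.
  by rewrite truncn_lt_nat// -mul2n natrM ltr_pM2l.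
by apply/eqP; rewrite eqn_leq -ltnS ltn_half_double h2 geq_half_double h1.
Qed.

(** For 0 <= x < 1 the convention x_0 = 0 agrees with the general formula. *)
Lemma dyadic_digitE x k : 0 <= x < 1 ->
  dyadic_digit x k = odd (Num.truncn (2 ^+ k * x)).
Proof.
move=> /andP[x0 x1]; rewrite /dyadic_digit; case: eqP => // ->.
by rewrite expr0 mul1r (@truncn_def _ _ 0%N)// x0 x1.
Qed.

(** The Dirichlet kernel of order 2^k is 2^k on the squares of the dyadic
intervals of level k.  Passing from k to k + 1 multiplies it by
1 + (-1)^(x_{k+1} + x_k + y_{k+1} + y_k); where the kernel of order 2^k does not
vanish one has x_k = y_k, so the factor is 2 or 0 according to whether
x_{k+1} = y_{k+1}. *)
Lemma walsh_dirichlet k x y : 0 <= x < 1 -> 0 <= y < 1 ->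
  \sum_(s < 2 ^ k) wal s x * wal s y =
  2 ^+ k * (Num.truncn (2 ^+ k * x) == Num.truncn (2 ^+ k * y))%:R.
Proof.
move=> x01 y01; have x0 : 0 <= x by case/andP: x01.
have y0 : 0 <= y by case/andP: y01.
elim: k => [|k IH].
  rewrite big_ord_recl big_ord0 /wal !big_ord0 expr0 !mul1r addr0.
  by rewrite !(@truncn_def _ _ 0%N).
rewrite expnS mul2n -addnn big_split_ord/=.
under [X in _ + X]eq_bigr => s _ do rewrite !wal_addn// mulrACA.
rewrite -mulr_suml -exprD IH -[X in X + _]mulr1 -mulrDr !dyadic_digitE//.
have Tk (z : R) : 0 <= z -> Num.truncn (2 ^+ k.+1 * z) =
    (odd (Num.truncn (2 ^+ k.+1 * z)) + (Num.truncn (2 ^+ k * z)).*2)%N.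
  move=> z0; rewrite -{1}[LHS]odd_double_half; congr (_ + _.*2)%N.
  rewrite exprS -mulrA; apply: truncn_double.
  by rewrite mulr_ge0// exprn_ge0.
have [e|ne] := eqVneq (Num.truncn (2 ^+ k * x)) (Num.truncn (2 ^+ k * y)).
  have -> : (Num.truncn (2 ^+ k.+1 * x) == Num.truncn (2 ^+ k.+1 * y)) =
      (odd (Num.truncn (2 ^+ k.+1 * x)) == odd (Num.truncn (2 ^+ k.+1 * y))).
    rewrite (Tk x x0) (Tk y y0) e eqn_add2r !oddD !odd_double !addbF !oddb.
    by do 2 case: odd.
  rewrite e mulr1 exprS -signr_odd !oddD !oddb.
  by do 3 case: odd => //=; rewrite ?expr0 ?expr1 ?subrr ?mulr0 ?mulr1// mulrC.
rewrite mulr0 mul0r; case: eqP => [e|_]; last by rewrite mulr0.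
move: ne; rewrite -(truncn_double (x := 2 ^+ k * x)) ?mulr_ge0 ?exprn_ge0//.
rewrite -(truncn_double (x := 2 ^+ k * y)) ?mulr_ge0 ?exprn_ge0//.
by rewrite !mulrA -!exprS e eqxx.
Qed.

(** Expand the step function in the kernels of [walsh_dirichlet] centred at the
points q / 2^k. *)
Lemma dyadic_step_walsh k (A : nat -> R) : exists c : nat -> R,
  forall x, 0 <= x < 1 -> dyadic_step k A x = \sum_(s < 2 ^ k) c s * wal s x.
Proof.
have p0 : (2 : R) ^+ k != 0 by rewrite expf_neq0.
(* The coefficients are those of the orthogonal projection on wal s. *)
exists (fun s => \sum_(q < 2 ^ k) A q / 2 ^+ k * wal s (q%:R / 2 ^+ k)) => x x01.
under eq_bigr => s _ do rewrite mulr_suml.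
rewrite exchange_big/=.
have q01 (q : 'I_(2 ^ k)) : 0 <= (q%:R / 2 ^+ k : R) < 1.
  rewrite divr_ge0 ?exprn_ge0//= ltr_pdivrMr ?exprn_gt0// mul1r -natrX ltr_nat.
  exact: ltn_ord.
have step (q : 'I_(2 ^ k)) : \sum_(s < 2 ^ k) A q / 2 ^+ k * wal s (q%:R / 2 ^+ k) * wal s x
    = A q * (q == Num.truncn (2 ^+ k * x) :> nat)%:R.
  under eq_bigr => s _ do rewrite -mulrA.
  rewrite -mulr_sumr walsh_dirichlet// mulrA divfK//.
  by rewrite mulrCA divff// mulr1 natrK.
rewrite (eq_bigr _ (fun q _ => step q)).
rewrite (bigD1 (Ordinal (truncn_dyadic_lt k x01)))//= eqxx mulr1 big1 ?addr0// => q qn.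
by case: eqP => [e|_]; rewrite ?mulr0//; move: qn; rewrite -val_eqE/= e eqxx.
Qed.

End WalshSteps.

(** * Integrals of tensor products on the cube *)

Section ProductIntegral.
Context {d1 d2 : measure_display} {T1 : measurableType d1} {T2 : measurableType d2}
  {R : realType}.
Variables (m1 : {sigma_finite_measure set T1 -> \bar R})
  (m2 : {sigma_finite_measure set T2 -> \bar R}).
Variables (u : T1 -> R) (v : T2 -> R).
Hypotheses (iu : m1.-integrable setT (EFin \o u))
  (iv : m2.-integrable setT (EFin \o v)).

Let f (z : T1 * T2) : \bar R := (u z.1 * v z.2)%:E.

Lemma integrable_prod : (m1 \x m2)%E.-integrable setT f.
Proof.
have [mu ui] := integrableP _ _ _ iu; have [mv vi] := integrableP _ _ _ iv.
have mf : measurable_fun setT f.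
  apply/measurable_EFinP; apply: measurable_funM.
    by apply: (@measurableT_comp _ _ _ _ _ _ u) => //; exact/measurable_EFinP.
  by apply: (@measurableT_comp _ _ _ _ _ _ v) => //; exact/measurable_EFinP.
apply/(integrable12ltyP m1 m2 mf).
rewrite (eq_integral (fun x => `|(u x)%:E| * \int[m2]_y `|(v y)%:E|)%E); last first.
  move=> x _; rewrite -ge0_integralZl//; last exact: measurableT_comp.
  by apply: eq_integral => y _; rewrite /f/= normrM.
rewrite ge0_integralZr//; last 2 first.
- exact: measurableT_comp.
- exact: integral_ge0.
by apply: lte_mul_pinfty => //; [exact: integral_ge0|rewrite ge0_fin_numE//; exact: integral_ge0].
Qed.

Lemma integral_prod :
  (\int[m1 \x m2]_z f z = (\int[m1]_x u x * \int[m2]_y v y)%:E)%E.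
Proof.
rewrite -(integral12_prod_meas1 integrable_prod) /fubini_F.
have fu := integrable_fin_num measurableT iu.
have fv := integrable_fin_num measurableT iv.
under eq_integral => x _ do
  (under eq_integral => y _ do rewrite /f/= EFinM; rewrite integralZl//).
rewrite /Rintegral EFinM !fineK//.
rewrite -[X in (_ * X)%E](fineK fv) -integralZr//.
by apply: eq_integral => x _; rewrite fineK.
Qed.

End ProductIntegral.

Section CubeMeasure.
Context {R : realType}.
Local Notation RM := (measurableTypeR R).

(** A constant of its own, so that finiteness of the measure can be attached to it
as an instance. *)
Definition cube (d : nat) : set (d.-tuple RM) -> \bar R := cube_measure d.

HB.instance Definition _ (d : nat) := Measure.copy (@cube d) (@cube_measure R d).

Lemma leb01T : @leb01 R setT = 1%E.
Proof.
rewrite /leb01 /mrestr setTI.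
have := lebesgue_measure_itv `[0 : R, 1]; rewrite /= lte01 oppr0 adde0 => <-.
by [].
Qed.

Lemma cube_measureT d : @cube_measure R d setT = 1%E.
Proof.
elim: d => [|d IH]; first by rewrite /= diracT.
rewrite /= /cube_step /pushforward preimage_setT -setXTT.
rewrite product_measure1E// IH mul1e; exact: leb01T.
Qed.

Lemma cube_fin d : fin_num_fun (@cube d).
Proof.
move=> A mA; rewrite ge0_fin_numE ?measure_ge0//.
apply: (@le_lt_trans _ _ (@cube d setT)).
  by apply: le_measure; rewrite ?inE.
by rewrite /cube cube_measureT ltry.
Qed.

HB.instance Definition _ (d : nat) := @Measure_isFinite.Build _ _ R (@cube d) (@cube_fin d).

Lemma ae_cube d (P : RM -> Prop) (k : 'I_d) : {ae @leb01 R, forall x, P x} ->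
  {ae @cube_measure R d, forall x, P (tnth x k)}.
Proof.
move=> [N [mN N0 PN]]; exists ((fun x => tnth x k) @^-1` N); split; last first.
- by move=> x /= nP; apply: PN.
- suff : forall d (k : 'I_d), @cube_measure R d ((fun x => tnth x k) @^-1` N) = 0%E by [].
  elim=> [|d' IH] k'; first by case: k'.
  rewrite /= /cube_step /pushforward.
  case: (unliftP ord0 k') => [j ->|->].
    have -> : cons_pair (d := d') @^-1` ((fun x => tnth x (lift ord0 j)) @^-1` N) =
        ((fun x => tnth x j) @^-1` N) `*` setT.
      by apply/seteqP; split => -[x y] /=; rewrite tnthS// => -[].
    rewrite product_measure1E// ?IH ?mul0e//.
    by rewrite -[X in measurable X]setTI; exact: measurable_tnth.
  have -> : cons_pair (d := d') @^-1` ((fun x => tnth x ord0) @^-1` N) = setT `*` N.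
    by apply/seteqP; split => -[x y] /=; rewrite tnth0// => -[].
  by rewrite product_measure1E// [X in (_ * X)%E]N0 mule0.
- by rewrite -[X in measurable X]setTI; exact: measurable_tnth.
Qed.

Definition tensor (d : nat) (f : 'I_d -> RM -> R) : d.-tuple RM -> R :=
  fun x => \prod_(k < d) f k (tnth x k).

Lemma measurable_tensor d (f : 'I_d -> RM -> R) :
  (forall k, measurable_fun setT (f k)) -> measurable_fun setT (tensor f).
Proof.
move=> mf; apply: measurable_prod => k _.
by apply: (measurableT_comp (mf k)); exact: measurable_tnth.
Qed.

Lemma tensor_integral d (f : 'I_d -> RM -> R) :
  (forall k, (@leb01 R).-integrable setT (EFin \o f k)) ->
  (@cube_measure R d).-integrable setT (EFin \o tensor f) /\
  (\int[@cube_measure R d]_x (tensor f x)%:E =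
     (\prod_(k < d) \int[@leb01 R]_x f k x)%:E)%E.
Proof.
elim: d f => [|d IH] f fi.
  have -> : tensor f = cst 1 by apply/funext => x; rewrite /tensor big_ord0.
  split; first exact: (@finite_measure_integrable_cst _ _ _ (@cube 0) setT 1).
  transitivity (\int[@cube_measure R 0]_x cst 1%E x)%E; first by [].
  by rewrite integral_cst// [X in (_ * X)%E]cube_measureT mule1 big_ord0.
have mf k : measurable_fun setT (f k).
  by apply/measurable_EFinP; case/integrableP: (fi k).
have [IHi IHe] := IH (fun k => f (lift ord0 k)) (fun k => fi _).
have ip := @integrable_prod _ _ _ _ R (@cube d) (@leb01 R) _ _ IHi (fi ord0).
have := @integral_prod _ _ _ _ R (@cube d) (@leb01 R) _ _ IHi (fi ord0).
have ce : (EFin \o tensor f) \o cons_pair (d := d) =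
    fun z => (tensor (fun k => f (lift ord0 k)) z.1 * f ord0 z.2)%:E.
  apply/funext => -[x y] /=; rewrite /tensor big_ord_recl tnth0 mulrC.
  by under eq_bigr => k _ do rewrite tnthS.
have mt : measurable_fun setT (EFin \o tensor f).
  by apply/measurable_EFinP; exact: measurable_tensor.
rewrite -ce in ip *; move=> ie; split.
  exact: (@integrable_pushforward _ _ _ _ _ _ (@measurable_cons_pair R d) _ setT _ mt ip).
transitivity (\int[pushforward (@cube d \x @leb01 R) (@cons_pair R d)]_x (EFin \o tensor f) x)%E.
  by [].
rewrite (@integral_pushforward _ _ _ _ _ _ (@measurable_cons_pair R d) _ setT _ mt ip)//.
rewrite preimage_setT ie; congr EFin.
by rewrite big_ord_recl mulrC; congr (_ * _); rewrite /Rintegral IHe.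
Qed.

Lemma sq_integrable_tensor d (f : 'I_d -> RM -> R) :
  (forall k, sq_integrable (@leb01 R) (f k)) ->
  sq_integrable (@cube_measure R d) (tensor f).
Proof.
move=> Sf; split; first by apply: measurable_tensor => k; exact: (Sf k).1.
have [+ _] := @tensor_integral d (fun k x => f k x * f k x) (fun k => (Sf k).2).
by congr (_.-integrable _ _); apply/funext => x /=; rewrite /tensor big_split.
Qed.

Lemma dotp_tensor d (f g : 'I_d -> RM -> R) :
  (forall k, sq_integrable (@leb01 R) (f k)) ->
  (forall k, sq_integrable (@leb01 R) (g k)) ->
  dotp (@cube_measure R d) (tensor f) (tensor g) =
  \prod_(k < d) dotp (@leb01 R) (f k) (g k).
Proof.
move=> Sf Sg; have [_ h] := @tensor_integral d (fun k x => f k x * g k x)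
  (fun k => sq_integrable_mul (Sf k) (Sg k)).
rewrite /dotp /Rintegral -[RHS]/(fine (_%:E)) -h; congr fine.
by apply: eq_integral => x _; rewrite /tensor big_split.
Qed.

End CubeMeasure.

(** * The scaling spaces on a dyadic cell *)

Section WalshL2.
Context {R : realType}.
Local Notation RM := (measurableTypeR R).

Lemma measurable_wal s : measurable_fun setT (wal s : RM -> R).
Proof.
pose B i (q : nat) : R :=
  (-1) ^+ (bin_digit s i * (if i == 0 then 0 else odd q))%N.
pose B' i (q : nat) : R := (-1) ^+ (bin_digit s i * odd q)%N.
have -> : wal s = fun x : RM =>
    \prod_(i < s) (dyadic_step i.+1 (B' i) x * dyadic_step i (B i) x).
  apply/funext => x; rewrite /wal expr_sum; apply: eq_bigr => i _.
  rewrite mulnDr exprD /dyadic_step /B /B' /dyadic_digit/=.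
  by case: (_ == _).
apply: measurable_prod => i _; apply: measurable_funM; exact: measurable_dyadic_step.
Qed.

Lemma normr_wal s (x : R) : `|wal s x| = 1.
Proof. by rewrite /wal normrX normrN1 expr1n. Qed.

Lemma sq_integrable_wal s : sq_integrable (@leb01 R) (wal s).
Proof.
apply: (@sq_integrable_bounded _ _ _ _ _ 1); first exact: measurable_wal.
by apply: nearW => x; rewrite normr_wal.
Qed.

End WalshL2.

Section Closure.
Context {d : measure_display} {T : measurableType d} {R : realType}.
Variable Q : (T -> R) -> Prop.
Hypotheses (Q0 : Q 0) (QD : forall f g, Q f -> Q g -> Q (f + g))
  (QZ : forall a f, Q f -> Q (a *: f)).

Lemma closed_lincomb n (c : 'I_n -> R) (g : 'I_n -> T -> R) :
  (forall i, Q (g i)) -> Q (fun x => \sum_(i < n) c i * g i x).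
Proof.
move=> Qg; rewrite (_ : (fun _ => _) = \sum_(i < n) c i *: g i).
  by apply: (big_ind Q) => // i _; exact: QZ.
by apply/funext => x; rewrite fct_sumE.
Qed.

Lemma closed_lspan A f : (forall g, A g -> Q g) -> lspan A f -> Q f.
Proof. by move=> QA [n [c [g [Ag ->]]]]; apply: closed_lincomb => i; apply: QA. Qed.

(** The boundary functions are not explicit because of the orthonormalization;
linear properties of phi (measurability, being spanned by a given family on each
cell) pass to them in this way. *)
Lemma closed_gram_schmidt (mu : {measure set T -> \bar R}) (v : nat -> T -> R) n :
  (forall k, Q (v k)) -> Q (gram_schmidt mu v n).
Proof.
move=> Qv; rewrite /gram_schmidt.
suff H m k : Q (nth (cst 0) (gram_schmidt_seq mu v m) k) by exact: H.
elim: m k => [|m IH] k; first by rewrite nth_nil.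
rewrite /= nth_rcons; case: ifP => // _; case: ifP => // _.
set s := gram_schmidt_seq mu v m in IH *.
apply: (QZ (_ : R)).
have -> : (fun x => v m x - \sum_(e <- s) dotp mu (v m) e * e x) =
    v m + (-1) *: (fun x => \sum_(i < size s) dotp mu (v m) (nth (cst 0) s i) * nth (cst 0) s i x).
  apply/funext => x; rewrite (big_nth (cst 0)) big_mkord.
  by rewrite scaleN1r.
by apply: QD => //; apply: QZ; apply: closed_lincomb.
Qed.

End Closure.

Section LocalBasis.
Context {R : realType}.
Local Notation RM := (measurableTypeR R).
Local Notation leb := (@lebesgue_measure R).
Local Notation leb01 := (@leb01 R).
Variables (p : nat) (phi : RM -> R).
Hypothesis hphi : daubechies p phi.

Let Sphi : sq_integrable leb phi := sq_integrable_Lfun (daubechies_L2 hphi).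

(** g on the unit cell that starts at q or, when s holds, read backwards on the
unit cell that ends at q. *)
Definition piece (g : RM -> R) (s : bool) (q : int) : RM -> R :=
  g \o affine ((-1) ^+ s) q%:~R.

Lemma sq_integrable_piece s q : sq_integrable leb01 (piece phi s q).
Proof.
apply: sq_integrable_leb01; apply: sq_integrable_affine Sphi.
by rewrite signr_eq0.
Qed.

Lemma piece_vanish s (q : int) : (p.+1 < `|q|)%N ->
  {ae leb01, forall t, piece phi s q t = 0}.
Proof.
move=> pq; apply/ae_leb01.
have s0 : (-1) ^+ s != 0 :> R by rewrite signr_eq0.
apply: (ae_sub (ae_affine q%:~R s0 (daubechies_supp hphi))) => t h t01.
apply: h; move: t01 => /=; rewrite !in_itv/= => /andP[t0 t1].
have hs : -1 <= (-1) ^+ s * t <= 1.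
  by case: s {s0} => /=; rewrite ?expr1 ?expr0 ?mulN1r ?mul1r; apply/andP; split; lra.
move: hs => /andP[hs1 hs2].
have qp : (p%:R + 1 + 1 : R) <= `|q%:~R|.
  by rewrite !natr1 -intr_norm -natr_absz ler_nat.
apply/negP => /andP[h1 h2]; move: qp; rewrite /affine in h1 h2 *.
rewrite leNgt => /negP; apply; rewrite ltr_norml; apply/andP; split; lra.
Qed.

(** Apply [exists_orthonormal] to the pieces with |q| <= p + 1; the remaining
ones vanish almost everywhere.  The e_b are cut off outside [0, 1[, so that their
dilates have disjoint supports. *)
Lemma local_basis : exists (D : nat) (e : nat -> RM -> R),
  [/\ forall b, (b < D)%N -> sq_integrable leb (e b),
      forall b t, ~ (0 <= t < 1) -> e b t = 0,
      forall a b, (a < D)%N -> (b < D)%N -> dotp leb01 (e a) (e b) = (a == b)%:R &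
      forall s q, exists c : nat -> R,
        {ae leb01, forall t, piece phi s q t = \sum_(b < D) c b * e b t}].
Proof.
have HB := sip_dotp leb01.
(* Both orientations of the 2p + 3 offsets q between -(p + 1) and p + 1. *)
pose y k := piece phi (odd k) (k./2%:Z - p.+1%:Z).
have Sy k : (k < (p.+1 + p.+2).*2)%N -> sq_integrable leb01 (y k).
  by move=> _; exact: sq_integrable_piece.
have [D [e0 [Se0 ON0 span0]]] := exists_orthonormal HB Sy.
pose e b t : R := if 0 <= t < 1 then e0 b t else 0.
have ee0 b : {ae leb01, forall t, e0 b t = e b t}.
  by apply: (ae_sub (@ae_leb01_in R)) => t t01; rewrite /e t01.
have ez b t : ~ (0 <= t < 1) -> e b t = 0 by rewrite /e; case: ifP.
have me b : (b < D)%N -> measurable_fun setT (e b : RM -> R).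
  move=> bD; rewrite (_ : e b = fun t => \1_(`[0, 1[%classic : set RM) t * e0 b t).
    apply: measurable_funM; last exact: (Se0 b bD).1.
    by apply: measurable_indic; exact: measurable_itv.
  apply/funext => t; rewrite indicE /e mem_setE in_itv/=.
  by case: ifP => _; rewrite ?mul1r ?mul0r.
have Se b : (b < D)%N -> sq_integrable leb01 (e b).
  by move=> bD; apply: (sq_integrable_ae (me b bD) (ee0 b)); exact: Se0.
exists D, e; split => //.
- move=> b bD; apply: sq_integrable_vanishing; last exact: Se.
  move=> x /= nx; apply: ez => /andP[x0 x1]; apply: nx.
  by rewrite in_itv/= x0 ltW.
- move=> a b aD bD; rewrite -ON0//; apply/esym/dotp_ae => //.
  + exact: Se0.
  + exact: Se.
  + exact: Se0.
  + exact: Se.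
- move=> s q; have [qp|pq] := leqP `|q|%N p.+1; last first.
    exists (fun=> 0); apply: (ae_sub (piece_vanish s pq)) => t ->.
    by rewrite big1// => b _; rewrite mul0r.
  (* k encodes the orientation s in its parity and q, shifted by p + 1, in its half. *)
  pose k0 := absz (q + p.+1%:Z); pose k := (s + k0.*2)%N.
  have k0E : k0%:Z = q + p.+1%:Z.
    by rewrite /k0 gez0_abs// -lerBlDr sub0r; move: qp; rewrite -lez_nat abszE ler_norml => /andP[].
  have k0lt : (k0 <= p.+1 + p.+1)%N.
    by rewrite -lez_nat k0E PoszD lerD2r; move: qp; rewrite -lez_nat abszE ler_norml => /andP[].
  have kN : (k < (p.+1 + p.+2).*2)%N.
    rewrite /k addnS doubleS; apply: (@leq_ltn_trans (1 + k0.*2)).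
      by rewrite leq_add2r; case: s @k.
    by rewrite add1n !ltnS leq_double.
  have yk : y k = piece phi s q.
    have ok : odd k = s by rewrite oddD odd_double addbF oddb.
    have hk : k./2 = k0 by rewrite halfD odd_double andbF add0n doubleK; case: (s).
    by rewrite /y ok hk k0E addrK.
  have [c hc] := span0 k kN; exists c.
  have Sz : sq_integrable leb01 (y k - \sum_(b < D) c b *: e0 b).
    by apply: (sipB HB); [exact: Sy|apply: (sip_lincomb HB) => b _; exact: Se0].
  have := dotp_null_ae Sz hc; rewrite yk => az.
  have ae : {ae leb01, forall t, 0 <= t < 1} := @ae_leb01_in R.
  apply: (ae_sub2 az ae) => t.
  rewrite -[_ t]/(piece phi s q t - (\sum_(b < D) c b *: e0 b) t) fct_sumE => /eqP.
  rewrite subr_eq0 => /eqP -> t01; apply: eq_bigr => b _.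
  by rewrite /e t01.
Qed.

End LocalBasis.

Section ScalingSpaces.
Context {R : realType}.
Local Notation RM := (measurableTypeR R).
Local Notation leb := (@lebesgue_measure R).
Local Notation leb01 := (@leb01 R).
Variables (D : nat) (e : nat -> RM -> R).

(** All pieces of g lie in the span of e_0, ..., e_{D-1}.  Both orientations are
included to make the property invariant under reflection, as the right boundary
functions require. *)
Definition locally_spanned (g : RM -> R) : Prop := forall s q, exists c : nat -> R,
  {ae leb01, forall t, piece g s q t = \sum_(b < D) c b * e b t}.

Lemma locally_spanned0 : locally_spanned 0.
Proof.
move=> s q; exists (fun=> 0); apply: nearW => t.
by rewrite big1// => b _; rewrite mul0r.
Qed.

Lemma locally_spannedD f g :
  locally_spanned f -> locally_spanned g -> locally_spanned (f + g).
Proof.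
move=> Lf Lg s q; have [c hc] := Lf s q; have [c' hc'] := Lg s q.
exists (fun b => c b + c' b); apply: (ae_sub2 hc hc') => t h h'.
rewrite -[LHS]/(piece f s q t + piece g s q t) h h' -big_split/=.
by apply: eq_bigr => b _; rewrite mulrDl.
Qed.

Lemma locally_spannedZ a f : locally_spanned f -> locally_spanned (a *: f).
Proof.
move=> Lf s q; have [c hc] := Lf s q.
exists (fun b => a * c b); apply: (ae_sub hc) => t h.
rewrite -[LHS]/(a * piece f s q t) h mulr_sumr.
by apply: eq_bigr => b _; rewrite mulrA.
Qed.

Lemma locally_spanned_shift (z : int) f g : (forall x, g x = f (x + z%:~R)) ->
  locally_spanned f -> locally_spanned g.
Proof.
move=> gf Lf s q; have [c hc] := Lf s (q + z); exists c; apply: (ae_sub hc) => t <-.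
by rewrite /piece /affine /= gf intrD addrA.
Qed.

Lemma locally_spanned_opp f g : (forall x, g x = f (- x)) ->
  locally_spanned f -> locally_spanned g.
Proof.
move=> gf Lf s q; have [c hc] := Lf (~~ s) (- q); exists c.
apply: (ae_sub hc) => t <-; rewrite /piece /affine /= gf opprD mulrNz -mulNr.
by case: s {hc}; rewrite /= ?expr0 ?expr1 ?opprK.
Qed.

Section Wavelet.
Variables (p : nat) (phi : RM -> R).
Hypothesis phi_spanned : locally_spanned phi.

Lemma locally_spanned_phi_left n : locally_spanned (phi_left p phi n).
Proof.
apply: closed_gram_schmidt; [exact: locally_spanned0|exact: locally_spannedD|
  exact: locally_spannedZ|] => k.
apply: closed_lincomb; [exact: locally_spanned0|exact: locally_spannedD|
  exact: locally_spannedZ|] => l.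
apply: (@locally_spanned_shift (l%:Z - p%:Z + 1) phi) => // x.
by rewrite !intrD mulrNz /= !addrA.
Qed.

Lemma phi_b_spanned r n (i : nat) : exists c : nat -> R,
  {ae leb01, forall t, phi_b p phi r n ((t + i%:R) / 2 ^+ r) =
     \sum_(b < D) c b * e b t}.
Proof.
have p0 : (2 : R) ^+ r != 0 by rewrite expf_neq0.
have e2 (t : R) : 2 ^+ r * ((t + i%:R) / 2 ^+ r) = t + i%:R by rewrite mulrC divfK.
have [g [q [Lg hg]]] : exists g (q : int), locally_spanned g /\ forall t,
    phi_b p phi r n ((t + i%:R) / 2 ^+ r) = Num.sqrt (2 ^+ r) * g (t + q%:~R).
  rewrite /phi_b; case: (n < p)%N; [|case: (n < 2 ^ r - p)%N].
  - exists (phi_left p phi n), i%:Z; split; first exact: locally_spanned_phi_left.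
    by move=> t; rewrite e2.
  - exists phi, (i%:Z - n%:Z); split => // t.
    by rewrite e2 intrD mulrNz addrA.
  - exists (phi_right p phi (2 ^ r - n - 1)), (i%:Z - (2 ^ r)%N%:Z); split.
      apply: (@locally_spanned_opp (phi_left p phi (2 ^ r - n - 1))) => //.
      exact: locally_spanned_phi_left.
    move=> t; rewrite mulrBr mulr1 e2.
    by rewrite intrD mulrNz addrA -[((2 ^ r)%N%:Z)%:~R]/((2 ^ r)%N%:R) natrX.
have [c hc] := locally_spannedZ (Num.sqrt (2 ^+ r)) Lg false q.
exists c; apply: (ae_sub hc) => t <-; rewrite hg /piece /affine /=.
by rewrite expr0 mul1r.
Qed.

Lemma V_b_spanned r (f : RM -> R) : V_b p phi r f -> forall i : nat,
  exists c : nat -> R,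
  {ae leb01, forall t, f ((t + i%:R) / 2 ^+ r) = \sum_(b < D) c b * e b t}.
Proof.
move=> Vf i; pose Q (f : RM -> R) := exists c : nat -> R,
  {ae leb01, forall t, f ((t + i%:R) / 2 ^+ r) = \sum_(b < D) c b * e b t}.
apply: (@closed_lspan _ _ _ Q _ _ _ _ _ _ Vf).
- exists (fun=> 0); apply: nearW => t.
  by rewrite big1// => b _; rewrite mul0r.
- move=> g h [c hc] [c' hc']; exists (fun b => c b + c' b).
  apply: (ae_sub2 hc hc') => t h1 h2.
  rewrite -[LHS]/(g _ + h _) h1 h2 -big_split/=.
  by apply: eq_bigr => b _; rewrite mulrDl.
- move=> a g [c hc]; exists (fun b => a * c b); apply: (ae_sub hc) => t h.
  rewrite -[LHS]/(a * g _) h mulr_sumr.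
  by apply: eq_bigr => b _; rewrite mulrA.
- by move=> g [n _ ->]; exact: phi_b_spanned.
Qed.

Hypothesis mphi : measurable_fun setT phi.

Lemma measurable_phi_left n : measurable_fun setT (phi_left p phi n).
Proof.
have Q0 : measurable_fun setT (0 : RM -> R) by exact: measurable_cst.
have QD (g h : RM -> R) : measurable_fun setT g -> measurable_fun setT h ->
  measurable_fun setT (g + h) by exact: measurable_funD.
have QZ a (g : RM -> R) : measurable_fun setT g -> measurable_fun setT (a *: g).
  by move=> mf; apply: measurable_funM.
apply: closed_gram_schmidt => // k; apply: closed_lincomb => // l.
apply: (@measurableT_comp _ _ _ _ _ _ phi) => //.
by apply: measurable_funD => //; apply: measurable_funB => //; exact: measurable_funD.
Qed.

Lemma measurable_V_b r (f : RM -> R) : V_b p phi r f -> measurable_fun setT f.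
Proof.
have Q0 : measurable_fun setT (0 : RM -> R) by exact: measurable_cst.
have QD (g h : RM -> R) : measurable_fun setT g -> measurable_fun setT h ->
  measurable_fun setT (g + h) by exact: measurable_funD.
have QZ a (g : RM -> R) : measurable_fun setT g -> measurable_fun setT (a *: g).
  by move=> mf; apply: measurable_funM.
move=> Vf; apply: (closed_lspan Q0 QD QZ _ Vf) => _ [n _ ->].
have m2 : measurable_fun setT (fun x : RM => 2 ^+ r * x) by exact: measurable_funM.
rewrite /phi_b; case: (n < p)%N; [|case: (n < 2 ^ r - p)%N]; apply: measurable_funM => //.
- by apply: (measurableT_comp (measurable_phi_left n)).
- by apply: (measurableT_comp mphi); exact: measurable_funB.
- apply: (measurableT_comp (measurable_phi_left _)); apply: measurableT_comp => //.
  by apply: measurable_funM => //; exact: measurable_funB.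
Qed.

End Wavelet.

Section Dilates.

Definition dilate r i (h : RM -> R) : RM -> R :=
  fun x => Num.sqrt (2 ^+ r) * h (2 ^+ r * x - i%:R).

Definition supp01 (h : RM -> R) := forall t, ~ (0 <= t < 1) -> h t = 0.

Let p0 r : (2 : R) ^+ r != 0. Proof. by rewrite expf_neq0. Qed.

Lemma dilateE r i h : dilate r i h =
  Num.sqrt (2 ^+ r) *: (h \o affine (2 ^+ r) (- i%:R)).
Proof. by []. Qed.

Lemma dilateB r i h k : dilate r i (h - k) = dilate r i h - dilate r i k.
Proof. by apply/funext => x; rewrite /dilate -[RHS]/(_ - _) -mulrBr. Qed.

Lemma dilate_supp r i h x : (i < 2 ^ r)%N -> supp01 h ->
  ~ `[0, 1]%classic x -> dilate r i h x = 0.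
Proof.
move=> ir hz; rewrite /= in_itv/= => nx; rewrite /dilate hz ?mulr0//.
move=> /andP[h1 h2]; apply: nx.
have pp : 0 < (2 : R) ^+ r by rewrite exprn_gt0.
have ir' : i%:R + 1 <= (2 : R) ^+ r by rewrite natr1 -natrX ler_nat.
have i0 : 0 <= i%:R :> R by [].
apply/andP; split; first by rewrite -(pmulr_rge0 _ pp); lra.
by rewrite -(ler_pM2l pp) mulr1; lra.
Qed.

Lemma dilate_disjoint r i j h k : i != j -> supp01 h -> supp01 k ->
  dotp leb01 (dilate r i h) (dilate r j k) = 0.
Proof.
move=> ij hz kz; rewrite /dotp (@eq_Rintegral _ _ _ _ _ (cst 0)).
  by rewrite /Rintegral integral0.
move=> x _; rewrite /dilate.
have [h0|] := pselect (0 <= 2 ^+ r * x - i%:R < 1); last by move/hz => ->; rewrite mulr0 mul0r.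
have [k0|] := pselect (0 <= 2 ^+ r * x - j%:R < 1); last by move/kz => ->; rewrite !mulr0.
exfalso; move/eqP: ij; apply.
have tr n : 0 <= 2 ^+ r * x - n%:R < 1 -> Num.truncn (2 ^+ r * x) = n.
  by move=> /andP[l1 l2]; apply: truncn_def; rewrite -natr1; apply/andP; split; lra.
by rewrite -(tr _ h0) (tr _ k0).
Qed.

Lemma sq_integrable_dilate_leb r i h : sq_integrable leb h ->
  sq_integrable leb (dilate r i h).
Proof. by move=> Sh; rewrite dilateE; apply/sq_integrableZ/sq_integrable_affine. Qed.

Lemma sq_integrable_dilate r i h : sq_integrable leb h ->
  sq_integrable leb01 (dilate r i h).
Proof. by move=> Sh; apply/sq_integrable_leb01/sq_integrable_dilate_leb. Qed.

Lemma supp01_vanish h : supp01 h -> forall x, ~ `[0, 1]%classic x -> h x = 0.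
Proof.
move=> hz x nx; apply: hz => /andP[x0 x1]; apply: nx.
by rewrite /= in_itv/= x0 ltW.
Qed.

Lemma norm_dilate r i h : (i < 2 ^ r)%N -> supp01 h -> sq_integrable leb h ->
  dotp leb01 (dilate r i h) (dilate r i h) = dotp leb01 h h.
Proof.
move=> ir hz Sh; rewrite dotp_vanishing; last 2 first.
- by move=> x; exact: dilate_supp.
- exact: sq_integrable_dilate_leb.
rewrite dotp_vanishing//; last exact: supp01_vanish.
rewrite (dotp_affine (- i%:R) (p0 r) Sh) dilateE.
have Sa := sq_integrable_affine (- i%:R) (p0 r) Sh.
have HB := sip_dotp leb; have SZ := sq_integrableZ (Num.sqrt (2 ^+ r)) Sa.
rewrite (sipZl HB)// (sipZr HB)// mulrA -expr2 sqr_sqrtr ?exprn_ge0//.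
by rewrite ger0_norm// exprn_ge0.
Qed.

(** Polarization of [norm_dilate]. *)
Lemma dotp_dilate r i h k : (i < 2 ^ r)%N -> supp01 h -> supp01 k ->
  sq_integrable leb h -> sq_integrable leb k ->
  dotp leb01 (dilate r i h) (dilate r i k) = dotp leb01 h k.
Proof.
move=> ir hz kz Sh Sk; have HB := sip_dotp leb01.
have hkz : supp01 (h - k) by move=> t nt; rewrite -[LHS]/(h t - k t) hz// kz// subrr.
have := norm_dilate ir hkz (sipB (sip_dotp leb) Sh Sk).
have Sbh := sq_integrable_dilate r i Sh; have Sbk := sq_integrable_dilate r i Sk.
have Sh' := sq_integrable_leb01 Sh; have Sk' := sq_integrable_leb01 Sk.
rewrite dilateB (sip_sqrB HB Sbh Sbk) (sip_sqrB HB Sh' Sk').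
rewrite norm_dilate// norm_dilate//; lra.
Qed.

(** On the cell i of level r, the dyadic interval number q of level j becomes the
one number i 2^j + q of level r + j. *)
Lemma dilate_dyadic_step j (A : nat -> R) h r i :
  (forall t, 0 <= t < 1 -> h t = dyadic_step j A t) -> supp01 h ->
  exists A' : nat -> R, forall x, 0 <= x < 1 ->
    dilate r i h x = dyadic_step (r + j) A' x.
Proof.
move=> hA hz.
exists (fun T => if (i * 2 ^ j <= T < i.+1 * 2 ^ j)%N
  then Num.sqrt (2 ^+ r) * A (T - i * 2 ^ j)%N else 0) => x /andP[x0 x1].
have XE : 2 ^+ (r + j) * x = 2 ^+ r * x * 2 ^+ j by rewrite exprD mulrAC.
have X0 : 0 <= 2 ^+ r * x * 2 ^+ j by rewrite !mulr_ge0// exprn_ge0.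
have pp : 0 < (2 : R) ^+ j by rewrite exprn_gt0.
rewrite /dyadic_step XE truncn_ge_nat// truncn_lt_nat// !natrM natrX.
rewrite ler_pM2r// ltr_pM2r//.
have -> : (i%:R <= 2 ^+ r * x < i.+1%:R) = (0 <= 2 ^+ r * x - i%:R < 1).
  by rewrite subr_ge0 ltrBlDr addrC natr1.
rewrite /dilate; case: ifPn => [t01|/negP nt]; last by rewrite hz// mulr0.
rewrite hA// /dyadic_step; congr (_ * A _); apply: truncn_def.
have := truncn_itv X0; set T := Num.truncn _ => /andP[T1 T2].
have iT : (i * 2 ^ j <= T)%N.
  rewrite /T truncn_ge_nat//.
  by rewrite natrM natrX ler_pM2r//; case/andP: t01; rewrite subr_ge0.
rewrite -(natr1 (T - _)%N) natrB// natrM natrX mulrBr; move: T2; rewrite -(natr1 T).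
rewrite (mulrC (2 ^+ j) (2 ^+ r * x)) (mulrC (2 ^+ j) i%:R) => T2.
by apply/andP; split; lra.
Qed.

(** On each cell f has coordinates in e_0, ..., e_{D-1}; elsewhere the dilates
attached to that cell vanish. *)
Lemma V_b_dilates (p : nat) (phi : RM -> R) r f :
  (forall b, (b < D)%N -> supp01 (e b)) -> locally_spanned phi ->
  V_b p phi r f -> exists c : 'I_(2 ^ r) * 'I_D -> R,
  {ae leb01, forall x, f x = \sum_a c a * dilate r a.1 (e a.2) x}.
Proof.
move=> ez Lphi /(V_b_spanned Lphi) /choice [c hc].
have s0 : Num.sqrt (2 ^+ r) != 0 :> R by rewrite gt_eqF// sqrtr_gt0 exprn_gt0.
exists (fun a : 'I_(2 ^ r) * 'I_D => c a.1 a.2 / Num.sqrt (2 ^+ r)).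
have : {ae leb, forall x, forall i, `[0, 1]%classic (affine (2 ^+ r) (- i%:R) x) ->
    f ((affine (2 ^+ r) (- i%:R) x + i%:R) / 2 ^+ r) =
    \sum_(b < D) c i b * e b (affine (2 ^+ r) (- i%:R) x)}.
  by apply/ae_foralln => i; apply: (@ae_affine _ _ _ (fun t => `[0, 1]%classic t ->
    f ((t + i%:R) / 2 ^+ r) = \sum_(b < D) c i b * e b t) (p0 r)); exact/ae_leb01.
move=> h; have {}h := (ae_leb01 _).1 (ae_sub h (fun x hx _ => hx)).
have h01 : {ae leb01, forall x, 0 <= x < 1} := @ae_leb01_in R.
apply: (ae_sub2 h h01) => x hx x01.
have ir := truncn_dyadic_lt r x01; set i := Num.truncn _ in ir.
have /andP[i1 i2] : i%:R <= 2 ^+ r * x < i.+1%:R.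
  by apply: truncn_itv; case/andP: x01 => x0 _; rewrite mulr_ge0// exprn_ge0.
have t01 : 0 <= 2 ^+ r * x - i%:R < 1.
  by move: i2; rewrite -natr1 => i2; apply/andP; split; lra.
have := hx i; rewrite /affine subrK (mulrC (2 ^+ r) x) mulfK// => ->; last first.
  by rewrite /= in_itv/= mulrC; case/andP: t01 => -> /ltW ->.
rewrite -(pair_bigA _ (fun (k : 'I_(2 ^ r)) (b : 'I_D) =>
  c k b / Num.sqrt (2 ^+ r) * dilate r k (e b) x))/=.
rewrite (bigD1 (Ordinal ir))//= [X in _ = _ + X]big1 ?addr0; last first.
  move=> k ki; rewrite big1// => b _; rewrite /dilate ez ?mulr0//.
  move=> /andP[k1 k2]; move/eqP: ki; apply; apply/val_inj => /=.
  by apply/esym/truncn_def; rewrite -natr1; apply/andP; split; lra.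
by apply: eq_bigr => b _; rewrite /dilate mulrA divfK// (mulrC x).
Qed.

End Dilates.

End ScalingSpaces.

(** * Walsh approximation of the scaling spaces *)

Section WalshApproximation.
Context {R : realType}.
Local Notation RM := (measurableTypeR R).
Local Notation leb := (@lebesgue_measure R).
Local Notation leb01 := (@leb01 R).

(** The step functions of level j approximating the e_b are chosen before r: the
dilations are isometric, so the same ones serve for all r and all cells. *)
Lemma walsh_dilate_approx (D : nat) (e : nat -> RM -> R) (eta : R) :
  (forall b, (b < D)%N -> sq_integrable leb (e b)) ->
  (forall b t, ~ (0 <= t < 1) -> e b t = 0) ->
  0 < eta ->
  exists j : nat, forall r : nat, exists G : 'I_(2 ^ r) * 'I_D -> RM -> R,
  [/\ forall a, exists c : nat -> R,
        forall x, G a x = \sum_(s < 2 ^ (r + j)) c s * wal s x,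
      forall (a b : 'I_(2 ^ r) * 'I_D), a.1 != b.1 -> dotp leb01 (dilate r a.1 (e a.2)) (G b) = 0,
      forall (a b : 'I_(2 ^ r) * 'I_D), a.1 != b.1 -> dotp leb01 (G a) (G b) = 0 &
      forall a : 'I_(2 ^ r) * 'I_D,
        dotp leb01 (dilate r a.1 (e a.2) - G a) (dilate r a.1 (e a.2) - G a) <= eta].
Proof.
move=> Se ez eta0.
have [j hj] : exists j, forall b : 'I_D, exists A : nat -> R,
    dotp leb01 (e b - dyadic_step j A) (e b - dyadic_step j A) <= eta.
  have : \forall j \near \oo, forall b : 'I_D, exists A : nat -> R,
      dotp leb01 (e b - dyadic_step j A) (e b - dyadic_step j A) <= eta.
    apply: filter_forall => b; apply: dyadic_step_dense => //.
    by apply: sq_integrable_leb01; exact: Se.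
  by case=> n _ /(_ n (leqnn n)); exists n.
have [A hA] := choice hj; exists j => r.
pose g (b : 'I_D) (t : RM) : R := if 0 <= t < 1 then dyadic_step j (A b) t else 0.
have gz b : supp01 (g b) by move=> t; rewrite /g; case: ifP.
have mg b : measurable_fun setT (g b).
  rewrite (_ : g b = fun t => \1_(`[0, 1[%classic : set RM) t * dyadic_step j (A b) t).
    apply: measurable_funM; last exact: measurable_dyadic_step.
    by apply: measurable_indic; exact: measurable_itv.
  apply/funext => t; rewrite indicE /g mem_setE in_itv/=.
  by case: ifP => _; rewrite ?mul1r ?mul0r.
have sg b : {ae leb01, forall t, dyadic_step j (A b) t = g b t}.
  by apply: (ae_sub (@ae_leb01_in R)) => t t01; rewrite /g t01.
have Sg01 b : sq_integrable leb01 (g b).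
  by apply: (sq_integrable_ae (mg b) (sg b)); exact: sq_integrable_dyadic_step.
have Sg b : sq_integrable leb (g b).
  by apply: sq_integrable_vanishing => //; exact: supp01_vanish.
have gE b t : 0 <= t < 1 -> g b t = dyadic_step j (A b) t by rewrite /g => ->.
have hc (a : 'I_(2 ^ r) * 'I_D) : exists c : nat -> R, forall x, 0 <= x < 1 ->
    dilate r a.1 (g a.2) x = \sum_(s < 2 ^ (r + j)) c s * wal s x.
  have [A' hA'] := dilate_dyadic_step r a.1 (gE a.2) (gz a.2).
  have [c hc] := dyadic_step_walsh (r + j) A'.
  by exists c => x x01; rewrite hA'// hc.
have [c {}hc] := choice hc.
pose G a (x : RM) := \sum_(s < 2 ^ (r + j)) c a s * wal s x.
have HB := sip_dotp leb01.
have SG a : sq_integrable leb01 (G a).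
  rewrite (_ : G a = \sum_(s < 2 ^ (r + j)) c a s *: (wal s : RM -> R)).
    by apply: (sip_lincomb HB) => s _; exact: sq_integrable_wal.
  by apply/funext => x; rewrite fct_sumE.
have Gg (a : 'I_(2 ^ r) * 'I_D) : {ae leb01, forall x, dilate r a.1 (g a.2) x = G a x}.
  by apply: (ae_sub (@ae_leb01_in R)) => t t01; rewrite hc.
have SE (a : 'I_(2 ^ r) * 'I_D) : sq_integrable leb01 (dilate r a.1 (e a.2)).
  by apply: sq_integrable_dilate; exact: Se.
have Sb (a : 'I_(2 ^ r) * 'I_D) : sq_integrable leb01 (dilate r a.1 (g a.2)).
  exact: sq_integrable_dilate.
have aeE (f : RM -> R) : {ae leb01, forall x, f x = f x} by exact: nearW.
exists G; split.
- by move=> a; exists (c a).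
- move=> a b ab.
  rewrite -(dotp_ae (SE a) (SE a) (Sb b) (SG b) (aeE _) (Gg b)).
  by apply: dilate_disjoint => //; exact: ez.
- move=> a b ab.
  rewrite -(dotp_ae (Sb a) (SG a) (Sb b) (SG b) (Gg a) (Gg b)).
  exact: dilate_disjoint.
- move=> a.
  have S1 := sipB HB (SE a) (Sb a); have S2 := sipB HB (SE a) (SG a).
  have ae1 : {ae leb01, forall x, (dilate r a.1 (e a.2) - dilate r a.1 (g a.2)) x =
      (dilate r a.1 (e a.2) - G a) x}.
    apply: (ae_sub (Gg a)) => x h.
    by rewrite -[LHS]/(_ - dilate r a.1 (g a.2) x) h.
  rewrite -(dotp_ae S1 S2 S1 S2 ae1 ae1) -dilateB norm_dilate//; last 2 first.
  + by move=> t nt; rewrite -[LHS]/(e a.2 t - g a.2 t) ez// gz// subrr.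
  + by apply: (sipB (sip_dotp leb)) => //; exact: Se.
  have Se1 : sq_integrable leb01 (e a.2) by apply/sq_integrable_leb01/Se.
  have Ss := sq_integrable_dyadic_step j (A a.2).
  have S3 := sipB HB Se1 (Sg01 a.2); have S4 := sipB HB Se1 Ss.
  have ae2 : {ae leb01, forall x, (e a.2 - dyadic_step j (A a.2)) x =
      (e a.2 - g a.2) x}.
    apply: (ae_sub (sg a.2)) => x h.
    by rewrite -[LHS]/(_ - dyadic_step j (A a.2) x) h.
  by rewrite -(dotp_ae S4 S3 S4 S3 ae2 ae2); exact: hA.
Qed.

End WalshApproximation.

Section TensorApproximation.
Context {R : realType}.
Local Notation RM := (measurableTypeR R).
Local Notation leb01 := (@leb01 R).
Variables (J : finType) (I : eqType) (blk : J -> I) (n d : nat).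
Variables (E G : J -> RM -> R) (eta : R).
Local Notation mu := (@cube_measure R d).
Hypotheses (SE : forall a, sq_integrable leb01 (E a))
  (SG : forall a, sq_integrable leb01 (G a))
  (EON : forall a b, dotp leb01 (E a) (E b) = (a == b)%:R)
  (EG0 : forall a b, blk a != blk b -> dotp leb01 (E a) (G b) = 0)
  (GG0 : forall a b, blk a != blk b -> dotp leb01 (G a) (G b) = 0)
  (near : forall a, dotp leb01 (E a - G a) (E a - G a) <= eta ^+ 2)
  (blkn : forall a, \sum_b (blk a == blk b)%:R = n%:R :> R)
  (eta01 : 0 < eta < 1).

(** A bound for |E_1 (x) ... (x) E_d - G_1 (x) ... (x) G_d|^2, that is for
1 - 2 prod <E_k, G_k> + prod <G_k, G_k>. *)
Definition tensor_error (x : R) : R := ((1 + x) ^+ 2) ^+ d - 2 * (1 - x) ^+ d + 1.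

Let HB1 := sip_dotp leb01.
Let HBd := sip_dotp mu.

(** Write z = E - G.  Then 1 - <E, G> = <E, z>, which is at most eta in absolute
value because 2 |<eta E, z>| <= eta^2 + |z|^2; and
<G, G> = |z|^2 - 1 + 2 <E, G>. *)
Lemma near_dotp a : 1 - eta <= dotp leb01 (E a) (G a) /\
  dotp leb01 (G a) (G a) <= (1 + eta) ^+ 2.
Proof.
have /andP[e0 e1] := eta01; have h := near a.
have Sz := sipB HB1 (SE a) (SG a).
have SZ := sipZ HB1 eta (SE a).
have E1 : dotp leb01 (E a) (E a) = 1 by rewrite EON eqxx.
have := sip_amgm HB1 SZ Sz.
rewrite (sipZr HB1 eta (SE a) SZ) !(sipZl HB1)// (sipBr HB1)// E1 mulr1.
rewrite normrM gtr0_norm// => h2.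
have {h2} : `|1 - dotp leb01 (E a) (G a)| <= eta.
  by rewrite -(ler_pM2l e0) (le_trans h2)//; move: h; rewrite expr2; lra.
rewrite ler_norml => /andP[h3 h4].
move: h; rewrite (sip_sqrB HB1)// E1 !expr2 => h.
by split; lra.
Qed.

Lemma dotp_tensor_basis (b b' : {ffun 'I_d -> J}) :
  dotp mu (tensor (fun k => E (b k))) (tensor (fun k => E (b' k))) = (b == b')%:R.
Proof.
rewrite dotp_tensor//; case: eqVneq => [->|bb'].
  by rewrite big1// => k _; rewrite EON eqxx.
have [k bk] : exists k, b k != b' k.
  apply/existsP; rewrite -negb_forall; apply: contra bb' => /forallP h.
  by apply/eqP/ffunP => k; apply/eqP.
by apply/eqP; apply/prodf_eq0; exists k => //; rewrite EON (negbTE bk).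
Qed.

Let F (b : {ffun 'I_d -> J}) : d.-tuple RM -> R :=
  tensor (fun k => E (b k)) - tensor (fun k => G (b k)).

Let StE (b : {ffun 'I_d -> J}) : sq_integrable mu (tensor (fun k => E (b k))).
Proof. exact: sq_integrable_tensor. Qed.

Let StG (b : {ffun 'I_d -> J}) : sq_integrable mu (tensor (fun k => G (b k))).
Proof. exact: sq_integrable_tensor. Qed.

Lemma tensor_error_bound b : dotp mu (F b) (F b) <= tensor_error eta.
Proof.
have /andP[e0 e1] := eta01.
have E1 := dotp_tensor_basis b b; rewrite eqxx /= in E1.
rewrite /F (sip_sqrB HBd)// E1 !dotp_tensor//.
have h1 : (1 - eta) ^+ d <= \prod_(k < d) dotp leb01 (E (b k)) (G (b k)).
  rewrite -[X in _ ^+ X]card_ord -prodr_const; apply: ler_prod => k _.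
  by rewrite subr_ge0 ltW//; have [] := near_dotp (b k).
have h2 : \prod_(k < d) dotp leb01 (G (b k)) (G (b k)) <= ((1 + eta) ^+ 2) ^+ d.
  rewrite -[X in _ <= _ ^+ X]card_ord -prodr_const; apply: ler_prod => k _.
  by rewrite (sip_ge0 HB1)//=; have [] := near_dotp (b k).
rewrite /tensor_error; lra.
Qed.

Let same_block (b b' : {ffun 'I_d -> J}) := [forall k, blk (b k) == blk (b' k)].

(** In a coordinate where the blocks differ, all four products of E and G have
inner product 0. *)
Lemma error_orthogonal b b' : ~~ same_block b b' -> dotp mu (F b) (F b') = 0.
Proof.
rewrite negb_forall => /existsP[k bk].
have pz (f g : J -> RM -> R) : (forall a, sq_integrable leb01 (f a)) ->
    (forall a, sq_integrable leb01 (g a)) -> dotp leb01 (f (b k)) (g (b' k)) = 0 ->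
    dotp mu (tensor (fun k => f (b k))) (tensor (fun k => g (b' k))) = 0.
  move=> Sf Sg fg; rewrite dotp_tensor//.
  by apply/eqP/prodf_eq0; exists k => //; rewrite fg.
have EE : dotp leb01 (E (b k)) (E (b' k)) = 0.
  by rewrite EON; have [ee|//] := eqVneq (b k) (b' k); rewrite ee eqxx in bk.
have SF := sipB HBd (StE b') (StG b').
rewrite /F (sipBl HBd)// !(sipBr HBd)// (pz E E)// (pz E G)//; last exact: EG0.
rewrite (pz G E)//; last by rewrite (sipC HB1)// EG0// eq_sym.
by rewrite (pz G G)// ?subrr//; exact: GG0.
Qed.

(** A block of the product family consists of n^d elements: this is the factor
lost in Schur's test. *)
Lemma tensor_approx (C : {ffun 'I_d -> J} -> R) u w :
  u = \sum_b C b *: tensor (fun k => E (b k)) ->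
  w = \sum_b C b *: tensor (fun k => G (b k)) ->
  dotp mu (u - w) (u - w) <= tensor_error eta * (n ^ d)%:R * dotp mu u u.
Proof.
move=> uE wE.
have -> : u - w = \sum_b C b *: F b.
  by rewrite uE wE -sumrB; apply: eq_bigr => b _; rewrite scalerBr.
have -> : dotp mu u u = \sum_b C b ^+ 2.
  rewrite uE (sip_lincombl HBd)//; last by apply: (sip_lincomb HBd).
  apply: eq_bigr => b _; rewrite (sip_lincombr HBd)// (bigD1 b)//=.
  rewrite dotp_tensor_basis eqxx mulr1 big1 ?addr0// => b' b'b.
  by rewrite dotp_tensor_basis eq_sym (negbTE b'b) mulr0.
apply: (@schur_bound _ _ _ _ HBd _ C F same_block).
- by move=> b b'; apply/eq_forallb => k; rewrite eq_sym.
- by move=> b; apply: (sipB HBd).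
- exact: tensor_error_bound.
- exact: error_orthogonal.
- move=> b.
  transitivity (\sum_(b' : {ffun 'I_d -> J}) \prod_(k < d) (blk (b k) == blk (b' k))%:R : R).
    apply: eq_bigr => b' _; have [/forallP h|] := boolP (same_block b b').
      by rewrite big1// => k _; rewrite h.
    rewrite negb_forall => /existsP[k hk]; apply/esym/eqP/prodf_eq0.
    by exists k => //; rewrite (negbTE hk).
  rewrite -(bigA_distr_bigA (fun k a => (blk (b k) == blk a)%:R : R)).
  by under eq_bigr => k _ do rewrite blkn; rewrite prodr_const card_ord natrX.
Qed.

End TensorApproximation.

Section Spans.
Context {disp : measure_display} {T : measurableType disp} {R : realType}.

Lemma lspan_sum (J : finType) (A : set (T -> R)) (c : J -> R) (g : J -> T -> R) :
  (forall a, A (g a)) -> lspan A (fun x => \sum_a c a * g a x).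
Proof.
move=> Ag; exists #|J|, (fun i => c (enum_val i)), (fun i => g (enum_val i)).
split => //; apply/funext => x.
by rewrite (reindex (@enum_val J J))//=; apply: onW_bij; exact: enum_val_bij.
Qed.

Lemma lspan_projection (mu : {measure set T -> \bar R}) (J : finType)
    (A : set (T -> R)) (g : J -> T -> R) (u : T -> R) :
  (forall a, A (g a)) -> (forall f, A f -> exists a, f = g a) ->
  (forall a, sq_integrable mu (g a)) -> sq_integrable mu u ->
  exists v, lspan A v /\ forall w, lspan A w -> dotp mu (u - v) w = 0.
Proof.
move=> Ag gA Sg Su; have HB := sip_dotp mu.
pose y (k : nat) : T -> R := if insub k is Some i then g (enum_val (i : 'I_#|J|)) else 0.
have yE (i : 'I_#|J|) : y i = g (enum_val i) by rewrite /y valK.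
have Sy k : (k < #|J|)%N -> sq_integrable mu (y k).
  by move=> kJ; rewrite -[k]/(val (Ordinal kJ)) yE.
have [c hc] := exists_projection HB Su Sy.
pose v x := \sum_(a : J) c (enum_rank a) * g a x.
have vE : v = \sum_(i < #|J|) c i *: y i.
  apply/funext => x; rewrite fct_sumE /v (reindex (@enum_val J J))/=; last first.
    by apply: onW_bij; exact: enum_val_bij.
  by apply: eq_bigr => i _; rewrite enum_valK yE.
have Sv : sq_integrable mu v.
  by rewrite vE; apply: (sip_lincomb HB) => i _; exact: Sy.
exists v; split; first exact: lspan_sum.
move=> w [n [cw [gw [Agw ->]]]].
have Sgw i : sq_integrable mu (gw i) by have [a ->] := gA _ (Agw i).
have -> : (fun x => \sum_(i < n) cw i * gw i x) = \sum_(i < n) cw i *: gw i.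
  by apply/funext => x; rewrite fct_sumE.
rewrite (sip_lincombr HB)//; last exact: (sipB HB).
apply: big1 => i _; have [a ->] := gA _ (Agw i).
have := hc (enum_rank a) (ltn_ord _); rewrite yE enum_rankK -vE => ->.
by rewrite mulr0.
Qed.

End Spans.

(** * The stable sampling rate *)

Section TensorSpaces.
Context {R : realType}.
Local Notation RM := (measurableTypeR R).
Local Notation leb01 := (@leb01 R).

(** Expand each factor and distribute the product over the sums. *)
Lemma tensor_power_expansion (d : nat) (V : set (RM -> R)) (J : finType)
    (E : J -> RM -> R) (u : d.-tuple RM -> R) :
  (forall f, V f -> measurable_fun setT f) ->
  (forall f, V f -> exists c : J -> R,
     {ae leb01, forall x, f x = \sum_a c a * E a x}) ->
  tensor_power V u ->
  measurable_fun setT u /\ exists C : {ffun 'I_d -> J} -> R,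
    {ae @cube_measure R d, forall x,
       u x = (\sum_b C b *: tensor (fun k => E (b k))) x}.
Proof.
move=> mV hV; set Q := (X in _ -> X).
pose Q' (u : d.-tuple RM -> R) := measurable_fun setT u /\
  exists C : {ffun 'I_d -> J} -> R, {ae @cube_measure R d, forall x,
       u x = (\sum_b C b *: tensor (fun k => E (b k))) x}.
apply: (@closed_lspan _ _ _ Q').
- split; first exact: measurable_cst.
  exists (fun=> 0); apply: nearW => x; rewrite big1// => b _.
  exact: scale0r.
- move=> f g [mf [C hC]] [mg [C' hC']]; split; first exact: measurable_funD.
  exists (fun b => C b + C' b); apply: (ae_sub2 hC hC') => x h h'.
  rewrite -[LHS]/(f x + g x) h h' !fct_sumE -big_split/=.
  by apply: eq_bigr => b _; rewrite -[LHS]/(_ * _ + _ * _) -mulrDl.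
- move=> a f [mf [C hC]]; split.
    by apply: measurable_funM => //; exact: measurable_cst.
  exists (fun b => a * C b); apply: (ae_sub hC) => x h.
  rewrite -[LHS]/(a * f x) h !fct_sumE mulr_sumr.
  by apply: eq_bigr => b _; rewrite -[LHS]/(_ * (_ * _)) mulrA.
- move=> _ [g Vg ->]; split.
    by apply: measurable_tensor => k; apply: mV.
  have [c hc] := choice (fun k => hV _ (Vg k)).
  exists (fun b => \prod_(k < d) c k (b k)).
  have : {ae @cube_measure R d, forall x, forall k : 'I_d,
      g k (tnth x k) = \sum_a c k a * E a (tnth x k)}.
    by apply: filter_forall => k; exact: (ae_cube k (hc k)).
  move=> h; apply: (ae_sub h) => x {}h.
  rewrite (eq_bigr _ (fun k _ => h k)).
  rewrite (bigA_distr_bigA (fun k a => c k a * E a (tnth x k))) fct_sumE.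
  by apply: eq_bigr => b _; rewrite big_split.
Qed.

Lemma tensor_Wal (d m : nat) (J : finType) (G : J -> RM -> R) (c : J -> nat -> R)
    (C : {ffun 'I_d -> J} -> R) :
  (forall a x, G a x = \sum_(s < m) c a s * wal s x) ->
  lspan [set g | exists2 l : 'I_d -> nat, (forall k, l k < m)%N & g = Wal l]
    (\sum_b C b *: tensor (fun k => G (b k))).
Proof.
move=> GE.
have -> : (\sum_b C b *: tensor (fun k => G (b k))) = fun x : d.-tuple RM =>
    \sum_(l : {ffun 'I_d -> 'I_m})
      (\sum_b C b * \prod_(k < d) c (b k) (l k)) * Wal (fun k => l k : nat) x.
  apply/funext => x; rewrite fct_sumE.
  under [RHS]eq_bigr => l _ do rewrite mulr_suml.
  rewrite exchange_big/=; apply: eq_bigr => b _.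
  rewrite -[LHS]/(C b * tensor (fun k => G (b k)) x) /tensor.
  rewrite (eq_bigr _ (fun k _ => GE (b k) (tnth x k))).
  rewrite (bigA_distr_bigA (fun k (s : 'I_m) => c (b k) s * wal s (tnth x k))).
  rewrite mulr_sumr; apply: eq_bigr => l _.
  by rewrite big_split/= mulrA.
apply: lspan_sum => l; exists (fun k => l k : nat) => //.
Qed.

Lemma sq_integrable_Wal (d : nat) (l : 'I_d -> nat) :
  sq_integrable (@cube_measure R d) (Wal l).
Proof.
apply: (@sq_integrable_tensor _ _ (fun k => wal (l k))) => k.
exact: sq_integrable_wal.
Qed.

Lemma exprD1_le (x : R) n : 0 <= x <= 1 -> (1 + x) ^+ n <= 1 + 3 ^+ n * x.
Proof.
move=> /andP[x0 x1]; elim: n => [|n IH]; first by rewrite !expr0; lra.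
have q1 : 1 <= (3 : R) ^+ n by apply: exprn_ege1; lra.
rewrite !exprS; set q := 3 ^+ n in IH q1 *.
apply: (@le_trans _ _ ((1 + x) * (1 + q * x))); first by rewrite ler_wpM2l//; lra.
have : q * x * x <= q * x by rewrite ler_piMr// mulr_ge0//; lra.
have : x <= q * x by rewrite ler_peMl.
lra.
Qed.

Lemma exprB1_ge (x : R) n : 0 <= x <= 1 -> 1 - n%:R * x <= (1 - x) ^+ n.
Proof.
move=> /andP[x0 x1]; elim: n => [|n IH]; first by rewrite expr0; lra.
rewrite exprS -natr1; apply: (@le_trans _ _ ((1 - x) * (1 - n%:R * x))).
  have : 0 <= n%:R * x * x by rewrite !mulr_ge0.
  lra.
by rewrite ler_wpM2l//; lra.
Qed.

Lemma tensor_error_small (d N : nat) (delta : R) : 0 < delta ->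
  exists eta : R, 0 < eta < 1 /\ tensor_error d eta * N%:R <= delta.
Proof.
move=> delta0; pose K : R := (3 ^+ (2 * d) + 2 * d%:R) * N%:R + 1.
have K0 : 0 < K by rewrite ltr_wpDl// mulr_ge0// addr_ge0// ?exprn_ge0// mulr_ge0.
pose eta := Num.min (delta / K) (1 / 2).
have eta0 : 0 < eta by rewrite lt_min !divr_gt0.
have eta1 : eta <= 1 / 2 by rewrite ge_min lexx orbT.
exists eta; split; first by apply/andP; split => //; lra.
have eta01 : 0 <= eta <= 1 by apply/andP; split; lra.
have err : tensor_error d eta <= (3 ^+ (2 * d) + 2 * d%:R) * eta.
  have := exprD1_le (2 * d) eta01; have := exprB1_ge d eta01.
  rewrite /tensor_error -exprM; lra.
apply: (@le_trans _ _ (K * eta)).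
  apply: (le_trans (ler_wpM2r (ler0n R N) err)).
  by rewrite /K; lra.
by rewrite mulrC -ler_pdivlMr// ge_min lexx.
Qed.

End TensorSpaces.

Section StableSampling.
Context {R : realType}.
Local Notation RM := (measurableTypeR R).
Variables (d p : nat) (phi : RM -> R).
Hypotheses (hd : (1 <= d)%N) (hphi : daubechies p phi).

(** The level j depends on theta through eta only; eta depends on theta, d and
the dimension D of the local space. *)
Lemma subspace_angle_walsh_le (theta : R) : 1 < theta ->
  exists j : nat, forall r m : nat, (2 ^ (r + j) <= m)%N ->
    (subspace_angle (cube_measure d) (reconstruction_space p phi d (2 ^ (d * r)))
       (sampling_space d (m ^ d)) <= theta%:E)%E.
Proof.
move=> theta1; have theta0 : 0 < theta by apply: lt_trans theta1.
have [D [e [Se ez eON Lphi]]] := local_basis hphi.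
have delta0 : 0 < 1 - theta ^- 2.
  by rewrite subr_gt0 invf_lt1 ?exprn_gt0// exprn_egt1// ltW.
have [eta [eta01 etad]] := tensor_error_small d (D ^ d) delta0.
have eta0 : 0 < eta by case/andP: eta01.
have [j hj] := walsh_dilate_approx Se ez (exprn_gt0 2 eta0).
exists j => r m rjm; have [G [GE EG0 GG0 near]] := hj r.
have mphi : measurable_fun setT phi := (sq_integrable_Lfun (daubechies_L2 hphi)).1.
pose E (a : 'I_(2 ^ r) * 'I_D) : RM -> R := dilate r a.1 (e a.2).
have SE a : sq_integrable (@leb01 R) (E a) by apply: sq_integrable_dilate; exact: Se.
have EON a b : dotp (@leb01 R) (E a) (E b) = (a == b)%:R.
  case: a b => [i a] [i' b]; rewrite /E/= xpair_eqE.
  have [->|ii'] := eqVneq i i'; last by rewrite dilate_disjoint//; exact: ez.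
  by rewrite dotp_dilate ?eON//; try exact: Se; try exact: ez.
have [c hc] := choice GE.
(* G uses only the first 2^(r+j) of the m available Walsh functions. *)
pose c' a s := if (s < 2 ^ (r + j))%N then c a s else 0.
have hc' a x : G a x = \sum_(s < m) c' a s * wal s x.
  rewrite hc (big_ord_widen m (fun s => c a s * wal s x))// big_mkcond/=.
  by apply: eq_bigr => s _; rewrite /c'; case: ifP => // _; rewrite mul0r.
have SG a : sq_integrable (@leb01 R) (G a).
  rewrite (_ : G a = \sum_(s < m) c' a s *: (wal s : RM -> R)).
    by apply: (sip_lincomb (sip_dotp _)) => s _; exact: sq_integrable_wal.
  by apply/funext => x; rewrite fct_sumE hc'.
have blkn (a : 'I_(2 ^ r) * 'I_D) : \sum_(b : 'I_(2 ^ r) * 'I_D) (a.1 == b.1)%:R = D%:R :> R.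
  rewrite -(pair_bigA _ (fun (i : 'I_(2 ^ r)) (b : 'I_D) => (a.1 == i)%:R))/=.
  rewrite (bigD1 a.1)//= eqxx sumr_const card_ord big1 ?addr0// => i ia.
  by rewrite eq_sym (negbTE ia) sumr_const mul0rn.
have dinj k k' : (k ^ d = k' ^ d)%N -> k = k'.
  by move=> /eqP; rewrite eqn_exp2r// => /eqP.
have recE u : reconstruction_space p phi d (2 ^ (d * r)) u -> tensor_power (V_b p phi r) u.
  move=> [r' /eqP]; rewrite eqn_exp2l// eqn_pmul2l// => /eqP ->; exact.
have samE u : @sampling_space R d (m ^ d) u <-> lspan [set g | exists2 l : 'I_d -> nat,
    (forall k, l k < m)%N & g = Wal l] u.
  split; last by move=> h; exists m.
  by move=> [m' /dinj ->].
have expand u : reconstruction_space p phi d (2 ^ (d * r)) u ->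
    measurable_fun setT u /\ exists C : {ffun 'I_d -> 'I_(2 ^ r) * 'I_D} -> R,
    {ae @cube_measure R d, forall x,
       u x = (\sum_b C b *: tensor (fun k => E (b k))) x}.
  move=> /recE; apply: tensor_power_expansion => f Vf.
    exact: measurable_V_b Vf.
  by apply: V_b_dilates Vf => // b _; exact: ez.
have HBd := sip_dotp (@cube_measure R d).
have SC (C : {ffun 'I_d -> 'I_(2 ^ r) * 'I_D} -> R) H :
    (forall a, sq_integrable (@leb01 R) (H a)) ->
    sq_integrable (@cube_measure R d) (\sum_b C b *: tensor (fun k => H (b k))).
  by move=> SH; apply: (sip_lincomb HBd) => b _; apply: sq_integrable_tensor.
have SU u : reconstruction_space p phi d (2 ^ (d * r)) u ->
    sq_integrable (@cube_measure R d) u.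
  move=> /expand[mu [C hC]]; apply: (sq_integrable_ae mu _ (SC C E SE)).
  by apply: (ae_sub hC) => x ->.
have gW (l : {ffun 'I_d -> 'I_m}) : [set g | exists2 l : 'I_d -> nat,
    (forall k, l k < m)%N & g = Wal l] (@Wal R d (fun k => l k : nat)).
  by exists (fun k => l k : nat).
have Wg (g : d.-tuple RM -> R) : [set g | exists2 l : 'I_d -> nat,
    (forall k, l k < m)%N & g = Wal l] g ->
    exists l : {ffun 'I_d -> 'I_m}, g = Wal (fun k => l k : nat).
  move=> [l lm ->]; exists [ffun k => Ordinal (lm k)]; congr Wal.
  by apply/funext => k; rewrite ffunE.
apply: subspace_angle_le => //.
- move=> w /samE [n [cw [gw [Agw ->]]]].
  rewrite (_ : (fun _ => _) = \sum_(i < n) cw i *: gw i).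
    apply: (sip_lincomb HBd) => i _; have [l _ ->] := Agw i.
    exact: sq_integrable_Wal.
  by apply/funext => x; rewrite fct_sumE.
- move=> u Su; have [v [Wv hv]] := lspan_projection gW Wg
    (fun l => sq_integrable_Wal _) Su.
  by exists v; split; [exact/samE|move=> w /samE; exact: hv].
- move=> u Uu uu1; have Su := SU u Uu.
  have [mu [C hC]] := expand u Uu.
  set u' := \sum_b C b *: tensor (fun k => E (b k)) in hC.
  pose w := \sum_b C b *: tensor (fun k => G (b k)).
  have Su' : sq_integrable (@cube_measure R d) u' by exact: SC.
  have Sw : sq_integrable (@cube_measure R d) w by exact: SC.
  exists w; first by apply/samE; exact: tensor_Wal hc'.
  have S1 := sipB HBd Su Sw; have S2 := sipB HBd Su' Sw.
  have ae1 : {ae @cube_measure R d, forall x, (u - w) x = (u' - w) x}.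
    by apply: (ae_sub hC) => x h; rewrite -[LHS]/(u x - w x) h.
  rewrite (dotp_ae S1 S2 S1 S2 ae1 ae1).
  have uu' : dotp (@cube_measure R d) u' u' = 1.
    by rewrite -(dotp_ae Su Su' Su Su' hC hC).
  have := @tensor_approx R _ _ (fun a : 'I_(2 ^ r) * 'I_D => a.1) D d E G eta SE SG EON
    EG0 GG0 near blkn eta01 C u' w erefl erefl.
  by rewrite uu' mulr1 => /le_trans; apply.
Qed.

(** The admissible number (2^(r+j))^d = 2^(dj) 2^(dr) is itself a competitor. *)
Lemma stable_sampling_rate_le (theta : R) (j r : nat) :
  (subspace_angle (cube_measure d) (reconstruction_space p phi d (2 ^ (d * r)))
     (sampling_space d ((2 ^ (r + j)) ^ d)) <= theta%:E)%E ->
  (stable_sampling_rate p phi d (2 ^ (d * r)) theta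
     <= ((2 ^ (d * j))%:R * (2 ^ (d * r))%:R)%:E)%E.
Proof.
move=> angle; apply: ereal_inf_lbound; exists ((2 ^ (r + j)) ^ d)%N.
  by split => //; exists (2 ^ (r + j))%N.
by rewrite -natrM -expnM -expnD mulnC mulnDr addnC.
Qed.

Lemma stable_sampling_rate_ge0 (theta : R) (N : nat) :
  (0 <= stable_sampling_rate p phi d N theta)%E.
Proof. by apply: le_ereal_inf_tmp => _ [M _ <-]; rewrite lee_fin. Qed.

End StableSampling.

Theorem theorem1p1 (R : realType) (d p : nat) (phi : measurableTypeR R -> R)
    (hd : (1 <= d)%N) (hp : (1 <= p)%N) (hphi : daubechies p phi) :
  (forall theta : R, 1 < theta ->
     exists S : R, 0 < S /\
       (forall r M : nat, (2 * p - 1 <= 2 ^ r)%N -> admissible d M ->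
          (2 ^ (d * r))%:R * S <= M%:R ->
          (subspace_angle (cube_measure d)
             (reconstruction_space p phi d (2 ^ (d * r)))
             (sampling_space d M) <= theta%:E)%E) /\
       (forall r : nat, (2 * p - 1 <= 2 ^ r)%N ->
          (stable_sampling_rate p phi d (2 ^ (d * r)) theta
             <= (S * (2 ^ (d * r))%:R)%:E)%E)) /\
  (forall theta : R, 1 < theta ->
     (\forall r \near \oo,
        stable_sampling_rate p phi d (2 ^ (d * r)) theta \is a fin_num) /\
     (fun r : nat => fine (stable_sampling_rate p phi d (2 ^ (d * r)) theta) : R^o)
       =O_\oo (fun r : nat => (2 ^ (d * r))%:R : R^o)).
Proof.
have bound theta : 1 < theta -> exists j : nat,
    (forall r m : nat, (2 ^ (r + j) <= m)%N ->
      (subspace_angle (cube_measure d) (reconstruction_space p phi d (2 ^ (d * r)))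
         (sampling_space d (m ^ d)) <= theta%:E)%E) /\
    forall r, (stable_sampling_rate p phi d (2 ^ (d * r)) theta
      <= ((2 ^ (d * j))%:R * (2 ^ (d * r))%:R)%:E)%E.
  move=> /(subspace_angle_walsh_le hd hphi)[j hj]; exists j; split=> // r.
  by apply: stable_sampling_rate_le; exact: hj.
split=> theta /bound[j [angle rate]].
- exists (2 ^ (d * j))%:R; split; first by rewrite ltr0n expn_gt0.
  split=> [r M _ [m ->]|r _]; last exact: rate.
  rewrite -natrM ler_nat -expnD -mulnDr mulnC expnM leq_exp2r//.
  exact: angle.
- split.
    apply: nearW => r; rewrite ge0_fin_numE ?stable_sampling_rate_ge0//.
    by rewrite (le_lt_trans (rate r))// ltry.
  apply/eqO_exP; exists (2 ^ (d * j))%:R; first by rewrite ltr0n expn_gt0.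
  apply: nearW => r /=; rewrite ger0_norm ?fine_ge0 ?stable_sampling_rate_ge0//.
  rewrite ger0_norm// -lee_fin fineK; first exact: rate.
  rewrite ge0_fin_numE ?stable_sampling_rate_ge0//.
  by rewrite (le_lt_trans (rate r))// ltry.
Qed.
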